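(* Let $V$ be an $N$-dimensional space of entire functions, and fix a scaling $(\Delta_\lambda(V(u)))_\lambda$ of the vector of Plücker coordinates of $V(u)$ so that every $\Delta_\lambda(V(u))$ is a meromorphic function of $u$. (i) (Jacobi–Trudi identity) For all partitions $\lambda$ and all $m\ge\ell(\lambda)$, $$\Delta_\lambda(V(u))=\Delta_\varnothing(V(u))^{1-m}\cdot\det\Bigg(\sum_{k=0}^{j-1}(-1)^k\binom{j-1}{k}\partial_u^k\Delta_{(\lambda_i-i+j-k)}(V(u))\Bigg)_{1\le i,j\le m}.$$ (ii) (dual Jacobi–Trudi identity) For all partitions $\lambda$ and all $m\ge\lambda_1$, $$\Delta_\lambda(V(u))=\Delta_\varnothing(V(u))^{1-m}\cdot\det\Bigg(\sum_{k=0}^{j-1}(-1)^k\binom{j-1}{k}\partial_u^k\Delta_{(1^{\lambda^*_i-i+j-k})}(V(u))\Bigg)_{1\le i,j\le m}.$$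
   Context: Partitions are identified up to trailing zeros; $\ell(\lambda)$ is the number of nonzero parts, $\lambda^*$ is the conjugate (transpose) partition, $\varnothing$ is the empty partition, $(i)$ is the one-row partition of $i$, and $(1^i)$ is the one-column partition of $i$ (so $(0)=(1^0)=\varnothing$). For an $N$-dimensional space $V$ of entire functions with basis $f_1,\dots,f_N$, the Plücker coordinates of the translate $V(u)=\{f(\,\cdot+u):f\in V\}$ are $$\det\big(\partial_u^{\lambda_{N-i+1}+i-1}f_j(u)\big)_{1\le i,j\le N}$$ for partitions $\lambda$ with $\ell(\lambda)\le N$, and $0$ for $\ell(\lambda)>N$; they are defined up to a common rescaling depending on $u$. A scaling for which all coordinates are meromorphic means $$\Delta_\lambda(V(u))=\phi(u)\det\big(\partial_u^{\lambda_{N-i+1}+i-1}f_j(u)\big)_{1\le i,j\le N}\quad(\ell(\lambda)\le N),\qquad\Delta_\lambda(V(u))=0\quad(\ell(\lambda)>N),$$ where $\phi$ is a meromorphic function on $\mathbb{C}$, not identically zero, independent of $\lambda$. By convention $\Delta_{(i)}(V(u))=\Delta_{(1^i)}(V(u))=0$ for $i<0$. The identities are between meromorphic functions of $u$ (note that $\Delta_\varnothing(V(u))$ is $\phi(u)$ times the Wronskian of $f_1,\dots,f_N$, which is not identically zero). *)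

(* Defs.v *)
From HB Require Import structures.
From mathcomp Require Import all_boot all_order all_algebra.
From mathcomp Require Import all_classical all_reals all_analysis.
From mathcomp Require Export complex.
Set Implicit Arguments.
Unset Strict Implicit.
Unset Printing Implicit Defensive.
Import Order.TTheory GRing.Theory Num.Theory.
Import numFieldNormedType.Exports.
Local Open Scope classical_set_scope.
Local Open Scope ring_scope.

(* A partition is represented by the sequence of its nonzero parts, so that
   [size] is the length and the part of 0-based index [i] is [nth 0 l i]. *)
Record intpart := IntPart {
  parts :> seq nat;
  partsP : sorted geq parts && (0%N \notin parts) }.

Definition part (l : intpart) (i : nat) : nat := nth 0%N l i.

Definition part0 : intpart := @IntPart [::] isT.

Lemma part_row_subproof (n : nat) :
  let s := if n is 0%N then [::] else [:: n] in
  sorted geq s && (0%N \notin s).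
Proof. by case: n. Qed.

Definition part_row (n : nat) : intpart := IntPart (part_row_subproof n).

Lemma part_col_subproof (n : nat) :
  sorted geq (nseq n 1%N) && (0%N \notin nseq n 1%N).
Proof.
rewrite mem_nseq andbF andbT.
by case: n => //= n; elim: n => //= n ->.
Qed.

Definition part_col (n : nat) : intpart := IntPart (part_col_subproof n).

Lemma part_conj_subproof (l : intpart) :
  let s := mkseq (fun i => count (fun p => (i < p)%N) l) (part l 0) in
  sorted geq s && (0%N \notin s).
Proof.
rewrite /part /=; apply/andP; split.
  apply/(sortedP 0%N) => i; rewrite size_mkseq => hi.
  rewrite !nth_mkseq ?(ltnW hi)//.
  by apply: sub_count => p /=; apply: ltnW.
apply/negP => /mapP[k]; rewrite mem_iota /= add0n => hk.
by case: (parts l) hk => //= a s ->.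
Qed.

Definition part_conj (l : intpart) : intpart := IntPart (part_conj_subproof l).

Section ComplexFunctions.
Variable R : realType.
(* The topology and normed module structure are inferred from [numFieldType]. *)
Local Notation C := (R[i] : numFieldType).

Definition entire (f : C -> C) : Prop := forall z : C, derivable f z 1.

(* The value of the total function [f] at any single point is irrelevant: only
   its germs on punctured neighbourhoods count, see [mero_eq]. *)
Definition meromorphic (f : C -> C) : Prop :=
  forall z0 : C, exists (n : nat) (g : C -> C),
    (\forall z \near z0, derivable g z 1) /\
    (\forall z \near z0^', f z = g z / (z - z0) ^+ n).

(* Equality of meromorphic functions: equality off a closed discrete set. *)
Definition mero_eq (f g : C -> C) : Prop :=
  forall z0 : C, \forall z \near z0^', f z = g z.

Definition is_basis (N : nat) (V : set (C -> C)) (f : 'I_N -> C -> C) : Prop :=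
  (forall c : 'I_N -> C,
     (forall z, \sum_(j < N) c j * f j z = 0) -> forall j, c j = 0) /\
  V = [set g | exists c : 'I_N -> C, forall z, g z = \sum_(j < N) c j * f j z].

(* Unscaled Pluecker coordinates at [u] of the translates of the span of [f];
   the 1-based exponent l_{N-i+1} + i - 1 is [part l (N - i.+1) + i] 0-based. *)
Definition plucker (N : nat) (f : 'I_N -> C -> C) (l : intpart) (u : C) : C :=
  if (size l <= N)%N then
    \det (\matrix_(i < N, j < N) derive1n (part l (N - i.+1) + i) (f j) u)
  else 0.

Definition at_row (D : intpart -> C -> C) (i : int) : C -> C :=
  if i is Posz n then D (part_row n) else fun=> 0.

Definition at_col (D : intpart -> C -> C) (i : int) : C -> C :=
  if i is Posz n then D (part_col n) else fun=> 0.

(* With 0-based indices, the entry in row [i] and column [j] is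
   sum_{k <= j} (-1)^k binom(j, k) d^k/du^k h_{l_i - i + j - k}(u). *)
Definition jt_matrix (m : nat) (h : int -> C -> C) (l : intpart) (u : C) :
    'M[C]_m :=
  \matrix_(i < m, j < m) \sum_(k < j.+1)
    (-1) ^+ k * 'C(j, k)%:R *
    derive1n k (h ((part l i)%:Z - i%:Z + j%:Z - k%:Z)) u.

End ComplexFunctions.

(* Main.v *)
Require Import Defs.
From HB Require Import structures.
From mathcomp Require Import all_boot all_order all_algebra.
From mathcomp Require Import all_classical all_reals all_analysis.
From mathcomp Require Import perm.
From mathcomp Require Import ring lra zify.

(** The identities hold at every point where the scaled Wronskian is nonzero
  and the functions involved are holomorphic; such points fill a punctured
  neighbourhood of each point of the plane.

  Algebra. Let [F_p] be the row of [p]-th derivatives of the basis, [h] the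
  coordinates of the one-row partitions, [S] the shift of their index and [d]
  the derivation. Expanding along the last row gives [h_(p + 1 - N) = F_p * g],
  where [g] is the column of scaled cofactors of the last row of the Wronskian
  matrix. The entries of the Jacobi-Trudi matrix are [((S - d) ^ j h)_a].
  Shifting the index of [h] replaces [F_p] by its derivative, so [S - d] acts
  on [F_p * g] as [- d] on [g] alone ([jt_op_row]). For [m = N] the matrix is
  therefore the product of the rows of the Pluecker determinant and a matrix
  independent of the partition, whose determinant follows from the triangular
  case of the empty partition ([jacobi_trudi]).

  The coordinates [e] of the one-column partitions are the coefficients of the
  linear relation between [F_0, ..., F_N] ([col_relation]). Its derivatives of
  order [r < m] are relations between [F_0, ..., F_(N + m - 1)] with
  coefficients [((S - d) ^ r e)_(N - p)], up to sign ([jt_op_col_relation]),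
  and the minor of [l] in the rows [F_p] is proportional to the complementary
  minor of the relations, which is the dual Jacobi-Trudi determinant
  ([dual_jacobi_trudi]). The sign of the shuffle of the two sets of rows is
  found by comparing Vandermonde determinants ([sign_shuffle]).

  Analysis. Entire functions are only assumed to be complex differentiable, so
  the existence of higher derivatives and the isolation of zeros must be
  established. No integral is needed: Goursat's bisection applies to the
  Riemann sums of a contour integral ([goursat]). In the coordinate given by
  the exponential it shows that averages over equidistant points of a circle do
  not depend on the radius, in the limit, even if the centre is excluded
  ([circle_mean_indep]). Applied to difference quotients, this yields the
  Cauchy estimate for the first derivative ([cauchy_estimate]), from which
  everything else follows: differentiability of the derivative
  ([derive1_cderiv]), Taylor bounds and the identity theorem
  ([mero_dichotomy]), and the non-vanishing of the Wronskian of independent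
  functions ([wronskian_neq0]). *)

Set Implicit Arguments.
Unset Strict Implicit.
Unset Printing Implicit Defensive.
Import Order.TTheory GRing.Theory Num.Theory.
Import numFieldNormedType.Exports.
Local Open Scope classical_set_scope.
Local Open Scope ring_scope.
Import ComplexField.
Local Notation nrm := Normc.normc.
Local Notation Re := complex.Re.
Local Notation Im := complex.Im.

(** * Complex differentiability through real error bounds *)

Section Elementary.
Variable R : realType.
Local Notation C := (R[i] : numFieldType).
Implicit Types (z w h : C) (f g : C -> C).

Lemma nrmE z : `|z| = (nrm z)%:C%C. Proof. by []. Qed.

Lemma nrm_ge0 z : 0 <= nrm z.
Proof. by rewrite -lecR -nrmE normr_ge0. Qed.

Lemma nrm0 : nrm (0 : C) = 0. Proof. exact: Normc.normc0. Qed.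

Lemma nrm_eq0 z : (nrm z == 0) = (z == 0).
Proof. by apply/eqP/eqP => [/Normc.eq0_normc//|->]; rewrite nrm0. Qed.

Lemma nrm_gt0 z : (0 < nrm z) = (z != 0).
Proof. by rewrite lt_neqAle nrm_ge0 andbT eq_sym nrm_eq0. Qed.

Lemma nrmN z : nrm (- z) = nrm z. Proof. exact: normcN. Qed.

Lemma nrmB z w : nrm (z - w) = nrm (w - z). Proof. by rewrite -nrmN opprB. Qed.

Lemma nrmD z w : nrm (z + w) <= nrm z + nrm w. Proof. exact: le_normcD. Qed.

Lemma nrmM z w : nrm (z * w) = nrm z * nrm w. Proof. exact: Normc.normcM. Qed.

Lemma nrmV z : nrm z^-1 = (nrm z)^-1. Proof. exact: Normc.normcV. Qed.

Lemma nrm1 : nrm (1 : C) = 1. Proof. exact: Normc.normc1. Qed.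

Lemma nrmX z n : nrm (z ^+ n) = nrm z ^+ n.
Proof. by elim: n => [|n IH]; rewrite ?expr0 ?nrm1// !exprS nrmM IH. Qed.

Lemma nrmR (x : R) : nrm (x%:C%C) = `|x|.
Proof. by rewrite /Normc.normc /= expr0n addr0 sqrtr_sqr. Qed.

Lemma nrm_sum (I : Type) (r : seq I) (P : pred I) (F : I -> C) :
  nrm (\sum_(i <- r | P i) F i) <= \sum_(i <- r | P i) nrm (F i).
Proof.
elim/big_ind2: _ => [|x1 x2 y1 y2 h1 h2|//]; first by rewrite nrm0.
by rewrite (le_trans (nrmD _ _))// lerD.
Qed.

Lemma nrm_Re z : `|Re z| <= nrm z.
Proof. by rewrite -lecR -nrmE normc_ge_Re. Qed.

Lemma nrm_Im z : `|Im z| <= nrm z.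
Proof.
case: z => a b /=; rewrite -sqrtr_sqr ler_wsqrtr// lerDr sqr_ge0//.
Qed.

Lemma nrm_le_ReIm z : nrm z <= `|Re z| + `|Im z|.
Proof.
case: z => a b /=.
rewrite -[leRHS]ger0_norm ?addr_ge0// -sqrtr_sqr ler_wsqrtr//.
rewrite sqrrD !real_normK ?num_real//.
by rewrite -subr_ge0 [X in 0 <= X](_ : _ = `|a| * `|b| *+ 2) ?mulrn_wge0 ?mulr_ge0//; ring.
Qed.

Lemma nearC (z0 : C) (P : C -> Prop) :
  (\forall z \near z0, P z) <->
  exists2 d : R, 0 < d & forall z, nrm (z - z0) < d -> P z.
Proof.
split=> [/nbhs_ballP[e /= e0 H]|[d d0 H]].
  have eR : e = (Re e)%:C%C by rewrite RRe_real// gtr0_real.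
  exists (Re e) => [|z zd]; first by rewrite -ltcR -eR.
  by apply: H; rewrite -ball_normE /= -opprB normrN nrmE eR ltcR.
apply/nbhs_ballP; exists (d%:C%C) => /=; first by rewrite ltcR.
by move=> z; rewrite -ball_normE /= -opprB normrN nrmE ltcR => /H.
Qed.

Lemma dnearC (z0 : C) (P : C -> Prop) :
  (\forall z \near z0^', P z) <->
  exists2 d : R, 0 < d & forall z, z != z0 -> nrm (z - z0) < d -> P z.
Proof.
rewrite near_withinE; split=> [/nearC[d d0 H]|[d d0 H]].
  by exists d => // z h1 h2; exact: H.
by apply/nearC; exists d => // z h1 h2; exact: H.
Qed.

(** The bounds live in the totally ordered field [R]: the order of [R[i]], in
  which its norm takes values, is only partial. *)
Definition cderiv (f : C -> C) z l := forall e : R, 0 < e ->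
  exists2 d : R, 0 < d & forall w, nrm (w - z) < d ->
    nrm (f w - f z - l * (w - z)) <= e * nrm (w - z).

(** Gives access to the differentiation rules for [is_derive]. *)
Lemma cderivP f z l : cderiv f z l <-> is_derive (z : C) 1 f l.
Proof.
suff H : cderiv f z l <->
    (h^-1 *: (f (h *: (1 : C) + z) - f z) @[h --> (0 : C)^'] --> (l : C)).
  rewrite H; split=> [cv|dv].
    split; first by apply/cvg_ex; exists l.
    exact: cvg_lim cv.
  have /derivableP := @ex_derive _ _ _ _ _ _ _ dv.
  move=> [/[swap] _ dfz]; have <- := @derive_val _ _ _ _ _ _ _ dv.
  exact: dfz.
have sc (h : C) : h *: (1 : C) = h by rewrite /GRing.scale /= mulr1.
split=> [D|cv e e0].
  apply/cvgrPdist_le => /= e e0.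
  have eR : e = (Re e)%:C%C by rewrite RRe_real// gtr0_real.
  have [|d d0 H] := D (Re e); first by rewrite -ltcR -eR.
  apply/dnearC; exists d => // h; rewrite subr0 => h0 hd.
  have := H (h + z); rewrite addrK => /(_ hd) le.
  rewrite nrmE eR lecR sc.
  rewrite -(@ler_pM2r _ (nrm h)) ?nrm_gt0// -nrmM.
  apply: le_trans le; rewrite -[leLHS]nrmN.
  rewrite [X in nrm X <= _](_ : _ = f (h + z) - f z - l * h)//.
  by rewrite /GRing.scale/=; field.
have /cvgrPdist_le /(_ (e%:C%C)) := cv; rewrite ltcR => /(_ e0) /dnearC[d d0 H].
exists d => // w wd.
have [->|wz] := eqVneq w z; first by rewrite !subrr nrm0 mulr0 subr0 nrm0 mulr0.
have := H (w - z); rewrite subr_eq0 subr0 => /(_ wz wd).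
rewrite sc nrmE lecR subrK => le.
have := ler_wpM2r (nrm_ge0 (w - z)) le; rewrite -nrmM => {}le.
apply: le_trans le; rewrite -[leLHS]nrmN.
rewrite [X in nrm X <= _](_ : _ = (l - (w - z)^-1 *: (f w - f z)) * (w - z))//.
by rewrite /GRing.scale/=; field; rewrite subr_eq0.
Qed.

Lemma derivableC f z : derivable f z 1 <-> exists l, cderiv f z l.
Proof.
split=> [/derivableP/cderivP|[l /cderivP[]//]]; by exists ('D_1 f z).
Qed.

Lemma cderiv_derive1 f z l : cderiv f z l -> derive1 f z = l.
Proof. by move=> /cderivP D; rewrite derive1E (@derive_val _ _ _ _ _ _ _ D). Qed.

Lemma cderivD f g z l k : cderiv f z l -> cderiv g z k ->
  cderiv (fun x => f x + g x) z (l + k).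
Proof. by move=> /cderivP ? /cderivP ?; apply/cderivP; exact: is_deriveD. Qed.

Lemma cderivN f z l : cderiv f z l -> cderiv (fun x => - f x) z (- l).
Proof. by move=> /cderivP ?; apply/cderivP; exact: is_deriveN. Qed.

Lemma cderivB f g z l k : cderiv f z l -> cderiv g z k ->
  cderiv (fun x => f x - g x) z (l - k).
Proof. by move=> ? ?; apply: cderivD => //; exact: cderivN. Qed.

Lemma cderivM f g z l k : cderiv f z l -> cderiv g z k ->
  cderiv (fun x => f x * g x) z (l * g z + f z * k).
Proof.
move=> /cderivP Hf /cderivP Hg; apply/cderivP.
have := is_deriveM Hf Hg; congr is_derive.
by rewrite /GRing.scale/= addrC mulrC.
Qed.

Lemma cderiv_cst c z : cderiv (fun=> c) z 0.
Proof. by apply/cderivP; exact: is_derive_cst. Qed.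

Lemma cderivZ c f z l : cderiv f z l -> cderiv (fun x => c * f x) z (c * l).
Proof. by move=> /(cderivM (cderiv_cst c z)); rewrite mul0r add0r. Qed.

Lemma cderiv_id z : cderiv id z 1.
Proof. by apply/cderivP; exact: is_derive_id. Qed.

Lemma cderiv_sum (I : Type) (r : seq I) (P : pred I) (F : I -> C -> C) (dF : I -> C) z :
  (forall i, P i -> cderiv (F i) z (dF i)) ->
  cderiv (fun x => \sum_(i <- r | P i) F i x) z (\sum_(i <- r | P i) dF i).
Proof.
move=> HF; elim: r => [|i r IH].
  by under eq_fun do rewrite big_nil; rewrite big_nil; exact: cderiv_cst.
under eq_fun do rewrite big_cons; rewrite big_cons.
have [Pi|_] := boolP (P i); last exact: IH.
by apply: cderivD => //; exact: HF.
Qed.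

Lemma cderivV f z l : f z != 0 -> cderiv f z l ->
  cderiv (fun x => (f x)^-1) z (- l / f z ^+ 2).
Proof.
move=> fz /cderivP Hf; apply/cderivP.
have Df := @ex_derive _ _ _ _ _ _ _ Hf.
split; first exact: derivableV.
rewrite deriveV// (@derive_val _ _ _ _ _ _ _ Hf).
by rewrite /GRing.scale/=; ring.
Qed.

Lemma cderiv_uniq f z l k : cderiv f z l -> cderiv f z k -> l = k.
Proof. by move=> /cderiv_derive1 <- /cderiv_derive1. Qed.

Lemma cderiv_near f g z l (d : R) : 0 < d ->
  (forall w, nrm (w - z) < d -> f w = g w) -> cderiv f z l -> cderiv g z l.
Proof.
move=> d0 fg Hf e /Hf[d' d'0 H].
exists (Num.min d d'); first by rewrite lt_min d0.
move=> w; rewrite lt_min => /andP[w1 w2]; rewrite -!fg//; first exact: H.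
by rewrite subrr nrm0.
Qed.

Lemma cderiv_cont f z l : cderiv f z l -> forall e : R, 0 < e ->
  exists2 d : R, 0 < d & forall w, nrm (w - z) < d -> nrm (f w - f z) <= e.
Proof.
move=> Hf e e0; have [d d0 H] := Hf 1 ltr01.
have l1 : 0 < 1 + nrm l by rewrite (lt_le_trans ltr01)// lerDl nrm_ge0.
exists (Num.min d (e / (1 + nrm l))); first by rewrite lt_min d0 divr_gt0.
move=> w; rewrite lt_min => /andP[wd]; rewrite ltr_pdivlMr// => /ltW we.
have {}H := H w wd.
rewrite (_ : f w - f z = (f w - f z - l * (w - z)) + l * (w - z)); last by rewrite subrK.
rewrite (le_trans (nrmD _ _))// nrmM (le_trans _ we)//.
by rewrite [leRHS]mulrDr mulr1 lerD//; [rewrite mul1r in H|rewrite mulrC].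
Qed.

Lemma cderiv_comp f g z l k : cderiv g z k -> cderiv f (g z) l ->
  cderiv (fun x => f (g x)) z (l * k).
Proof.
move=> Hg Hf e e0.
have k1 : 0 < 1 + nrm k by rewrite (lt_le_trans ltr01)// lerDl nrm_ge0.
have l1 : 0 < 1 + nrm l by rewrite (lt_le_trans ltr01)// lerDl nrm_ge0.
have [|d1 d10 H1] := Hf (e / 2 / (1 + nrm k)); first by rewrite !divr_gt0.
have e20 : 0 < Num.min 1 (e / 2 / (1 + nrm l)) by rewrite lt_min ltr01 !divr_gt0.
have [d2 d20 H2] := Hg _ e20.
have [|d3 d30 H3] := cderiv_cont Hg (_ : 0 < d1 / 2); first by rewrite divr_gt0.
exists (Num.min d2 d3); first by rewrite lt_min d20.
move=> w; rewrite lt_min => /andP[w2 w3].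
have {}H3 : nrm (g w - g z) < d1 by rewrite (le_lt_trans (H3 _ w3))// gtr_pMr// invf_lt1// ltr1n.
have {}H1 := H1 _ H3; have {}H2 := H2 _ w2.
have n0 := nrm_ge0 (w - z).
have H2a : nrm (g w - g z - k * (w - z)) <= nrm (w - z).
  by rewrite (le_trans H2)// -[leRHS]mul1r ler_wpM2r// ge_min lexx.
have H2b : nrm (g w - g z - k * (w - z)) <= e / 2 / (1 + nrm l) * nrm (w - z).
  by rewrite (le_trans H2)// ler_wpM2r// ge_min lexx orbT.
have H4 : nrm (g w - g z) <= (1 + nrm k) * nrm (w - z).
  rewrite (_ : g w - g z = (g w - g z - k * (w - z)) + k * (w - z)); last by rewrite subrK.
  by rewrite (le_trans (nrmD _ _))// nrmM [leRHS]mulrDl mul1r lerD.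
rewrite (_ : _ - _ = (f (g w) - f (g z) - l * (g w - g z)) +
  l * (g w - g z - k * (w - z))); last by ring.
rewrite (le_trans (nrmD _ _))// (splitr e) [leRHS]mulrDl lerD//.
  by rewrite (le_trans H1)// -mulrA ler_pM2l ?divr_gt0// ler_pdivrMl.
rewrite nrmM.
have := ler_wpM2l (nrm_ge0 l) H2b => /le_trans; apply.
rewrite mulrA ler_wpM2r// mulrA ler_pdivrMr// mulrC ler_pM2l ?divr_gt0//.
by rewrite lerDr.
Qed.

End Elementary.

(** * Goursat's theorem for Riemann sums *)

Section Goursat.
Variable R : realType.
Local Notation C := (R[i] : numFieldType).
Implicit Types (f g : C -> C) (z a b p : C).

Definition edge_sum (f : C -> C) n (z a : C) : C :=
  a / 2 ^+ n * \sum_(j < 2 ^ n) f (z + a * (j%:R / 2 ^+ n)).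

(** Riemann sum of the integral along the boundary of the parallelogram with
  vertex [z] and sides [a], [b]. The left endpoints of the [2 ^ n] pieces of
  each side make the sums add up exactly when the parallelogram is cut into
  four, see [contour_sumS]. *)
Definition contour_sum (f : C -> C) n (z a b : C) : C :=
  edge_sum f n z a - edge_sum f n (z + b) a +
  (edge_sum f n (z + a) b - edge_sum f n z b).

Lemma edge_sumS f n z a :
  edge_sum f n.+1 z a = edge_sum f n z (a / 2) + edge_sum f n (z + a / 2) (a / 2).
Proof.
have n20 : (2 ^+ n : C) != 0 by rewrite expf_neq0// pnatr_eq0.
rewrite /edge_sum -mulrDr; congr (_ * _); first by rewrite exprS; field.
rewrite expnS mul2n -addnn big_split_ord/=; congr (_ + _).
  by apply: eq_bigr => j _; congr (f (z + _)); rewrite exprS; field.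
apply: eq_bigr => j _; congr f.
by rewrite natrD natrX exprS; field.
Qed.

(** The two sums along each inner edge cancel. *)
Lemma contour_sumS f n z a b :
  contour_sum f n.+1 z a b =
    contour_sum f n z (a / 2) (b / 2) +
    contour_sum f n (z + a / 2) (a / 2) (b / 2) +
    contour_sum f n (z + b / 2) (a / 2) (b / 2) +
    contour_sum f n (z + a / 2 + b / 2) (a / 2) (b / 2).
Proof.
rewrite /contour_sum !edge_sumS.
have -> : z + a / 2 + b / 2 + b / 2 = z + b + a / 2 by field.
have -> : z + a / 2 + b / 2 + a / 2 = z + a + b / 2 by field.
have -> : z + b / 2 + a / 2 = z + a / 2 + b / 2 by field.
have -> : z + a / 2 + a / 2 = z + a by field.
have -> : z + b / 2 + b / 2 = z + b by field.
ring.
Qed.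

Lemma sum_cst_over n (c : C) : 2 ^- n * \sum_(j < 2 ^ n) c = c.
Proof.
rewrite sumr_const card_ord -[c *+ _]mulr_natl natrX mulrA mulVf ?mul1r//.
Qed.

(** On two opposite sides the values of an affine function differ by a
  constant, so that the errors of the left endpoint rule cancel without any
  limit. *)
Lemma contour_sum_affine n z a b (c d : C) :
  contour_sum (fun x => c + d * x) n z a b = 0.
Proof.
have E u v : edge_sum (fun x => c + d * x) n (z + u) v =
    edge_sum (fun x => c + d * x) n z v + v * (d * u).
  rewrite /edge_sum -[d * u in RHS](sum_cst_over n) mulrA -mulrDr -big_split/=.
  by congr (_ * _); apply: eq_bigr => j _; ring.
by rewrite /contour_sum !E; ring.
Qed.

Lemma contour_sumB f g n z a b :
  contour_sum f n z a b - contour_sum g n z a b =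
  contour_sum (fun x => f x - g x) n z a b.
Proof. by rewrite /contour_sum /edge_sum !sumrB; ring. Qed.

Lemma edge_sum_le f n z a (K : R) :
  (forall s : R, 0 <= s <= 1 -> nrm (f (z + a * s%:C%C)) <= K) ->
  nrm (edge_sum f n z a) <= nrm a * K.
Proof.
move=> fK; rewrite /edge_sum !nrmM -mulrA ler_wpM2l ?nrm_ge0//.
have n20 : 0 < (2 ^+ n : R) by rewrite exprn_gt0.
rewrite nrmV nrmX (_ : nrm 2 = 2); last first.
  by rewrite -(rmorph_nat (real_complex R)) nrmR ger0_norm.
rewrite mulrC ler_pdivrMr// (le_trans (nrm_sum _ _ _))//.
apply: (@le_trans _ _ (\sum_(j < 2 ^ n) K)); last first.
  by rewrite sumr_const card_ord -[K *+ _]mulr_natr natrX.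
apply: ler_sum => j _.
have := fK (j%:R / 2 ^+ n).
rewrite divr_ge0 ?ler0n ?(ltW n20)//= ler_pdivrMr// mul1r -natrX ler_nat.
by rewrite rmorphM fmorphV !rmorph_nat natrX; apply; rewrite ltnW.
Qed.

Lemma contour_sum_le f n z a b (K : R) :
  (forall s t : R, 0 <= s <= 1 -> 0 <= t <= 1 ->
     nrm (f (z + a * s%:C%C + b * t%:C%C)) <= K) ->
  nrm (contour_sum f n z a b) <= 2 * (nrm a + nrm b) * K.
Proof.
move=> fK; rewrite /contour_sum.
have h0 : 0 <= (0 : R) <= 1 by rewrite lexx ler01.
have h1 : 0 <= (1 : R) <= 1 by rewrite lexx ler01.
have r0 : ((0 : R)%:C)%C = 0 :> C by [].
have r1 : ((1 : R)%:C)%C = 1 :> C by [].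
rewrite (le_trans (nrmD _ _))//.
rewrite (_ : 2 * _ * K = (nrm a * K + nrm a * K) + (nrm b * K + nrm b * K)); last by ring.
apply: lerD; rewrite (le_trans (nrmD _ _))// lerD// ?nrmN; apply: edge_sum_le => s hs.
- by have := fK s 0 hs h0; rewrite r0 mulr0 addr0.
- by have := fK s 1 hs h1; rewrite r1 mulr1 addrAC.
- by have := fK 1 s h1 hs; rewrite r1 mulr1.
- by have := fK 0 s h0 hs; rewrite r0 mulr0 addr0.
Qed.

(** Bisection: if the sums do not become small, then neither do those of some
  nested sequence of quarters, in proportion to their areas. The quarters
  shrink to a point, near which [f] is affine up to an error of smaller order,
  and an affine function contributes nothing. *)
Lemma goursat f z a b :
  (forall s t : R, 0 <= s <= 1 -> 0 <= t <= 1 ->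
     exists l, cderiv f (z + a * s%:C%C + b * t%:C%C) l) ->
  forall e : R, 0 < e -> exists n0, forall n, (n0 <= n)%N ->
    nrm (contour_sum f n z a b) <= e.
Proof.
move=> fd e e0; apply: contrapT => bad0.
pose q l := 2 ^- l : R.
have q0 l : 0 < q l by rewrite invr_gt0 exprn_gt0.
have qS l : q l.+1 = q l / 2 by rewrite /q exprS invfM mulrC.
pose base (x : R * R) := z + a * (x.1)%:C%C + b * (x.2)%:C%C.
(* [x] holds the coordinates of the lower left vertex and [q l] the scale. *)
pose good l x := exists n0, forall n, (n0 <= n)%N ->
  nrm (contour_sum f n (base x) (a * (q l)%:C%C) (b * (q l)%:C%C)) <= e * q l ^+ 2.
pose near l (u v : R) := (u <= v) && (v + q l.+1 <= u + q l).
(* The implication inside the existential turns the step into a total choice. *)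
have step l x : exists y, ~ good l x ->
    [/\ near l x.1 y.1, near l x.2 y.2 & ~ good l.+1 y].
  have [g|ng] := pselect (good l x); first by exists x.
  apply: contrapT => no.
  have goodS (y : R * R) : near l x.1 y.1 -> near l x.2 y.2 -> good l.+1 y.
    by move=> h1 h2; apply: contrapT => h3; apply: no; exists y.
  have n1 (u : R) : near l u u by rewrite /near lexx lerD2l qS; have := q0 l; lra.
  have n2 (u : R) : near l u (u + q l.+1).
    by rewrite /near -addrA lerD2l qS; have := q0 l; lra.
  apply: ng.
  have [m1 g1] := goodS (x.1, x.2) (n1 _) (n1 _).
  have [m2 g2] := goodS (x.1 + q l.+1, x.2) (n2 _) (n1 _).
  have [m3 g3] := goodS (x.1, x.2 + q l.+1) (n1 _) (n2 _).
  have [m4 g4] := goodS (x.1 + q l.+1, x.2 + q l.+1) (n2 _) (n2 _).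
  exists (m1 + m2 + m3 + m4).+1 => -[//|n] mn.
  have {}g1 := g1 n ltac:(lia); have {}g2 := g2 n ltac:(lia).
  have {}g3 := g3 n ltac:(lia); have {}g4 := g4 n ltac:(lia).
  rewrite contour_sumS.
  have hq : (q l.+1)%:C%C = (q l)%:C%C / 2 :> C.
    by rewrite qS rmorphM; congr (_ * _); rewrite fmorphV rmorph_nat.
  have ha (c : C) : c * (q l)%:C%C / 2 = c * (q l.+1)%:C%C by rewrite hq mulrA.
  rewrite !ha.
  have b2 : base (x.1 + q l.+1, x.2) = base x + a * (q l.+1)%:C%C.
    by rewrite /base/= rmorphD/=; ring.
  have b3 : base (x.1, x.2 + q l.+1) = base x + b * (q l.+1)%:C%C.
    by rewrite /base/= rmorphD/=; ring.
  have b4 : base (x.1 + q l.+1, x.2 + q l.+1) =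
      base x + a * (q l.+1)%:C%C + b * (q l.+1)%:C%C.
    by rewrite /base/= !rmorphD/=; ring.
  rewrite b2 in g2; rewrite b3 in g3; rewrite b4 in g4.
  have -> : e * q l ^+ 2 = e * q l.+1 ^+ 2 + e * q l.+1 ^+ 2 +
    e * q l.+1 ^+ 2 + e * q l.+1 ^+ 2 by rewrite qS; field.
  by rewrite (le_trans (nrmD _ _))// lerD// (le_trans (nrmD _ _))// lerD//
    (le_trans (nrmD _ _))// lerD.
have /choice [F HF] : forall lx : nat * (R * R), exists y, ~ good lx.1 lx.2 ->
    [/\ near lx.1 lx.2.1 y.1, near lx.1 lx.2.2 y.2 & ~ good lx.1.+1 y].
  by case=> l x; exact: step.
pose X := fix X l := if l is k.+1 then F (k, X k) else (0, 0) : R * R.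
have badX l : ~ good l (X l).
  elim: l => [|l /(HF (l, _))[]//].
  move=> [n0 g]; apply: bad0; exists n0 => n /g.
  by rewrite /base/= /q expr0 invr1 expr1n !mulr1 !mulr0 !addr0.
have nearX l : near l (X l).1 (X l.+1).1 /\ near l (X l).2 (X l.+1).2.
  by have [] := HF (l, X l) (badX l).
have lim (u : nat -> R) : u 0%N = 0 -> (forall l, near l (u l) (u l.+1)) ->
    exists2 s, 0 <= s <= 1 & forall l, u l <= s <= u l + q l.
  move=> u0 hu.
  have mono k l : (k <= l)%N -> u k <= u l /\ u l + q l <= u k + q k.
    move=> /subnK <-; elim: (l - k)%N => [|m [IH1 IH2]]; first by rewrite add0n.
    have /andP[h1 h2] := hu (m + k)%N; rewrite addSn; split.
      exact: le_trans h1.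
    exact: le_trans h2 _.
  have ub k l : u k <= u l + q l.
    have [kl|/ltnW lk] := leqP k l.
      by have [h _] := mono _ _ kl; rewrite (le_trans h)// lerDl ltW.
    by have [_ h] := mono _ _ lk; rewrite (le_trans _ h)// lerDl ltW.
  have hs : has_sup (range u).
    by split; [exists (u 0%N); exists 0%N|exists (u 0%N + q 0%N) => _ [k _ <-]].
  have H l : u l <= sup (range u) <= u l + q l.
    apply/andP; split; first by apply: ub_le_sup; [exact: hs.2|exists l].
    by apply: ge_sup; [exact: hs.1|move=> _ [k _ <-]].
  exists (sup (range u)) => //.
  by have := H 0%N; rewrite u0 add0r /q expr0 invr1.
have [s s01 Hs] := lim (fun l => (X l).1) erefl (fun l => (nearX l).1).
have [t t01 Ht] := lim (fun l => (X l).2) erefl (fun l => (nearX l).2).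
have [d Hd] := fd _ _ s01 t01.
set p := z + _ + _ in Hd.
(* The [l]-th parallelogram has diameter at most [M * q l]. *)
pose M := nrm a + nrm b.
have M0 : 0 <= M by rewrite addr_ge0 ?nrm_ge0.
have M1 : 0 < 2 * M ^+ 2 + 1 by rewrite ltr_wpDl// mulr_ge0// sqr_ge0.
have [r r0 Hr] := Hd (e / (2 * M ^+ 2 + 1)) (divr_gt0 e0 M1).
have [l Hl] : exists l, M * q l < r.
  have [k hk] : exists k, M / r < k%:R.
    by exists (Num.bound (M / r)); rewrite archi_boundP// divr_ge0// ltW.
  exists k; rewrite ltr_pdivrMr ?exprn_gt0// -ltr_pdivrMl// mulrC (lt_trans hk)//.
  by rewrite -natrX ltr_nat ltn_expl.
apply: (badX l); exists 0%N => n _.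
have bnd (s' t' : R) : 0 <= s' <= 1 -> 0 <= t' <= 1 ->
    nrm (base (X l) + a * (q l)%:C%C * s'%:C%C + b * (q l)%:C%C * t'%:C%C - p)
      <= M * q l.
  move=> /andP[s0 s1] /andP[t0 t1].
  rewrite (_ : _ - p = a * ((X l).1 + q l * s' - s)%:C%C +
                       b * ((X l).2 + q l * t' - t)%:C%C); last first.
    by rewrite /p /base !(rmorphD, rmorphB, rmorphM)/=; ring.
  have ql := ltW (q0 l).
  rewrite (le_trans (nrmD _ _))// !nrmM !nrmR mulrDl lerD// ler_wpM2l ?nrm_ge0//.
    rewrite ler_norml; have /andP[h1 h2] := Hs l.
    have := ler_wpM2l ql s1; have := mulr_ge0 ql s0; lra.
  rewrite ler_norml; have /andP[h1 h2] := Ht l.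
  have := ler_wpM2l ql t1; have := mulr_ge0 ql t0; lra.
rewrite -[contour_sum _ _ _ _ _]subr0.
rewrite -(contour_sum_affine n (base (X l)) (a * (q l)%:C%C) (b * (q l)%:C%C)
  (f p - d * p) d).
rewrite contour_sumB.
apply: (le_trans (contour_sum_le (K := e / (2 * M ^+ 2 + 1) * (M * q l)) _ _)).
  move=> s' t' hs' ht'; have := bnd _ _ hs' ht'.
  set x := (base _ + _ + _) => hx.
  have := Hr x (le_lt_trans hx Hl).
  rewrite (_ : f x - f p - _ = f x - (f p - d * p + d * x)); last by ring.
  move=> /le_trans; apply; rewrite ler_wpM2l// divr_ge0// ltW//.
rewrite !nrmM !nrmR ger0_norm ?(ltW (q0 l))// -mulrDl -/M.
rewrite [leLHS](_ : _ = e * q l ^+ 2 * (2 * M ^+ 2 / (2 * M ^+ 2 + 1))); last first.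
  by field; rewrite lt0r_neq0.
rewrite -[leRHS]mulr1 ler_wpM2l ?mulr_ge0 ?(ltW e0) ?(ltW (q0 l))//.
by rewrite ler_pdivrMr// mul1r lerDl.
Qed.

End Goursat.

(** * Mean values over circles and the Cauchy estimate *)

Section CauchyEstimate.
Variable R : realType.
Local Notation C := (R[i] : numFieldType).
Implicit Types (f g : C -> C) (z w a : C).

(** Real error bounds for components carry over to the complex plane, whose
  filters differ. *)
Lemma is_derive_bound (f : R -> R) (x l : R) : is_derive x 1 f l ->
  forall e : R, 0 < e -> exists2 d : R, 0 < d & forall h, `|h| < d ->
    `|f (h + x) - f x - l * h| <= e * `|h|.
Proof.
move=> D e e0.
have /derivableP := @ex_derive _ _ _ _ _ _ _ D.
move=> [/[swap] _ dfz].
have dl := @derive_val _ _ _ _ _ _ _ D.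
have {}dfz : (h^-1 *: (f (h *: (1 : R) + x) - f x) @[h --> (0 : R)^'] --> (l : R)).
  by rewrite -dl; exact: dfz.
have /cvgrPdist_le /(_ e e0) := dfz.
rewrite near_withinE => /nbhs_ballP[d /= d0 H].
exists d => // h hd.
have [->|h0] := eqVneq h 0; first by rewrite add0r subrr mulr0 subr0 normr0 mulr0.
have := H h; rewrite -ball_normE /= sub0r normrN => /(_ hd h0).
rewrite /GRing.scale/= mulr1 => le.
have := ler_wpM2r (normr_ge0 h) le; rewrite -normrM => {}le.
apply: le_trans le; rewrite -[leLHS]normrN le_eqVlt; apply/orP; left; apply/eqP.
by congr `|_|; field.
Qed.

Definition cexp (w : C) : C :=
  (expR (Re w))%:C%C * (cos (Im w) +i* sin (Im w))%C.

Lemma cexpD z w : cexp (z + w) = cexp z * cexp w.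
Proof.
case: z w => [a b] [c d]; rewrite /cexp/= expRD cosD sinD.
by apply/eqP; rewrite eq_complex/=; apply/andP; split; apply/eqP; ring.
Qed.

Lemma nrm_cexp w : nrm (cexp w) = expR (Re w).
Proof.
by rewrite nrmM nrmR ger0_norm ?expR_ge0//= cos2Dsin2 sqrtr1 mulr1.
Qed.

Lemma cexp2pi w : cexp (w + (0 +i* (pi *+ 2))%C) = cexp w.
Proof. by case: w => x y; rewrite /cexp/= addr0 cosD2pi sinD2pi. Qed.

Lemma cexp0 : cexp 0 = 1.
Proof. by rewrite /cexp/= expR0 cos0 sin0 mul1r. Qed.

(** The three real expansions of [expR], [cos] and [sin] at 0, each with
  relative error [e / 10], add up to an error of at most [6 / 10 * e]. *)
Lemma cderiv_cexp0 : cderiv cexp 0 1.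
Proof.
move=> e e0.
pose k := Num.min 1 (e / 10).
have k0 : 0 < k by rewrite lt_min ltr01 divr_gt0.
have k1 : k <= 1 by rewrite ge_min lexx.
have ke : k <= e / 10 by rewrite ge_min lexx orbT.
have [d1 d10 H1] := is_derive_bound (is_derive_expR (0 : R)) k0.
have [d2 d20 H2] := is_derive_bound (is_derive_cos (0 : R)) k0.
have [d3 d30 H3] := is_derive_bound (is_derive_sin (0 : R)) k0.
exists (Num.min (Num.min d1 d2) (Num.min d3 (k / 2))).
  by rewrite !lt_min d10 d20 d30 divr_gt0.
move=> w; rewrite !subr0 !lt_min => /andP[/andP[w1 w2] /andP[w3 wk]].
have hx := nrm_Re w; have hy := nrm_Im w.
have {H1} := H1 (Re w) (le_lt_trans hx w1).
have {H2} := H2 (Im w) (le_lt_trans hy w2).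
have {H3} := H3 (Im w) (le_lt_trans hy w3).
rewrite cexp0 !addr0 expR0 cos0 sin0 !(oppr0, mul0r, subr0, addr0, mul1r).
set x := Re w in hx *; set y := Im w in hy *; set n := nrm w in hx hy wk *.
move=> h3 h2 h1.
have hkx := ler_wpM2l (ltW k0) hx; have hky := ler_wpM2l (ltW k0) hy.
have {}h1 := le_trans h1 hkx; have {}h2 := le_trans h2 hky.
have {}h3 := le_trans h3 hky.
have n0 : 0 <= n by exact: nrm_ge0.
have E1 : `|expR x - 1| <= 2 * n.
  rewrite (_ : expR x - 1 = (expR x - 1 - x) + x); last by ring.
  rewrite (le_trans (ler_normD _ _))//.
  have := ler_wpM2r n0 k1; lra.
have E2 : `|expR x| <= 2.
  rewrite (_ : expR x = (expR x - 1) + 1); last by ring.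
  rewrite (le_trans (ler_normD _ _))// normr1; lra.
rewrite (le_trans (nrm_le_ReIm _))//.
have -> : Re (cexp w - 1 - w) = expR x * (cos y - 1) + (expR x - 1 - x).
  by rewrite /x /y /cexp; case: (w) => a b /=; ring.
have -> : Im (cexp w - 1 - w) = expR x * (sin y - y) + (expR x - 1) * y.
  by rewrite /x /y /cexp; case: (w) => a b /=; ring.
have A1 := ler_normD (expR x * (cos y - 1)) (expR x - 1 - x).
have A2 := ler_normD (expR x * (sin y - y)) ((expR x - 1) * y).
rewrite !normrM in A1 A2.
have B1 := ler_pM (normr_ge0 _) (normr_ge0 _) E2 h2.
have B2 := ler_pM (normr_ge0 _) (normr_ge0 _) E2 h3.
have B3 := ler_pM (normr_ge0 _) (normr_ge0 _) E1 hy.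
have B4 := ler_wpM2r n0 (ltW wk).
have B5 := ler_wpM2r n0 ke.
have B6 := mulr_ge0 (ltW e0) n0.
lra.
Qed.

(** The functional equation moves the expansion at 0 to every point. *)
Lemma cderiv_cexp z : cderiv cexp z (cexp z).
Proof.
have D : cderiv (fun w => cexp z * cexp (w - z)) z (cexp z).
  rewrite -[X in cderiv _ _ X](_ : 0 * cexp (z - z) + cexp z * (1 * (1 - 0)) = _);
    last by rewrite mul0r add0r subr0 !mulr1.
  apply: cderivM (cderiv_cst _ _) _.
  apply: cderiv_comp; first exact: cderivB (cderiv_id _) (cderiv_cst _ _).
  by rewrite subrr; exact: cderiv_cexp0.
apply: cderiv_near ltr01 _ D => w _.
by rewrite -cexpD addrC subrK.
Qed.

(** Riemann sum of the mean value of [f] over the circle of centre [a] and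
  radius [expR s]. *)
Definition circle_mean f a (s : R) n : C :=
  2 ^- n * \sum_(j < 2 ^ n)
    f (a + cexp (s%:C%C + (0 +i* (pi *+ 2))%C * (j%:R / 2 ^+ n))).

(** In the coordinate [w] with [x = cexp w] the annulus between the two circles
  is a rectangle of height [2 * pi]. Its horizontal sides cancel by
  periodicity, and [goursat] compares the vertical ones. The annulus leaves out
  the centre, at which difference quotients are not known to be
  differentiable. *)
Lemma circle_mean_indep f a (s1 s2 : R) : s1 <= s2 ->
  (forall x, 0 < nrm x <= expR s2 -> exists l, cderiv f (a + x) l) ->
  forall e : R, 0 < e -> exists n0, forall n, (n0 <= n)%N ->
    nrm (circle_mean f a s2 n - circle_mean f a s1 n) <= e.
Proof.
move=> s12 fd e e0.
pose P : C := (0 +i* (pi *+ 2))%C.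
have P0 : 0 < nrm P by rewrite nrm_gt0 eq_complex/= eqxx/= mulrn_eq0/= gt_eqF// pi_gt0.
have [|n0 H] := @goursat R (fun w => f (a + cexp w)) (s1%:C%C) ((s2 - s1)%:C%C) P _
  (nrm P * e) (mulr_gt0 P0 e0).
  move=> s t /andP[s0 s1'] /andP[t0 t1].
  set w := _ + _ + _.
  have [|l Hl] := fd (cexp w).
    rewrite nrm_cexp expR_gt0/= ler_expR /w/= !mul0r !mulr0 !subr0 !addr0.
    have : 0 <= s2 - s1 by rewrite subr_ge0.
    by move=> /(ler_wpM2l) => /(_ _ _ s1'); lra.
  exists (l * (0 + cexp w)); apply: (cderiv_comp (g := fun w => a + cexp w)) Hl.
  by apply: cderivD (cderiv_cst _ _) (cderiv_cexp _).
exists n0 => n /H.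
suff -> : contour_sum (fun w => f (a + cexp w)) n s1%:C%C (s2 - s1)%:C%C P =
    P * (circle_mean f a s2 n - circle_mean f a s1 n) by rewrite nrmM ler_pM2l.
rewrite /contour_sum /edge_sum.
rewrite (eq_bigr (fun j : 'I_(2 ^ n) =>
    f (a + cexp (s1%:C%C + P + (s2 - s1)%:C%C * (j%:R / 2 ^+ n))))); last first.
  by move=> j _; rewrite [s1%:C%C + P + _]addrAC cexp2pi.
have -> : s1%:C%C + (s2 - s1)%:C%C = s2%:C%C :> C by rewrite rmorphB addrC subrK.
by rewrite subrr add0r /circle_mean -/P; ring.
Qed.

Lemma nrm_circle_mean f a s n (M : R) :
  (forall x, nrm x = expR s -> nrm (f (a + x)) <= M) ->
  nrm (circle_mean f a s n) <= M.
Proof.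
move=> fM; rewrite /circle_mean nrmM nrmV nrmX.
rewrite (_ : nrm 2 = 2); last first.
  by rewrite -(rmorph_nat (real_complex R)) nrmR ger0_norm.
rewrite mulrC ler_pdivrMr ?exprn_gt0// (le_trans (nrm_sum _ _ _))//.
apply: (@le_trans _ _ (\sum_(j < 2 ^ n) M)); last first.
  by rewrite sumr_const card_ord -[M *+ _]mulr_natr natrX.
apply: ler_sum => j _; apply: fM; rewrite nrm_cexp.
rewrite (_ : j%:R / 2 ^+ n = (j%:R / 2 ^+ n : R)%:C%C); last first.
  by rewrite rmorphM fmorphV rmorphXn !rmorph_nat.
by rewrite /= !mul0r mulr0 subr0 addr0.
Qed.

(** The mean over a tiny circle is close to [f a] by continuity alone. This
  covers difference quotients at [a], extended by the derivative. *)
Lemma max_center f a (r M : R) : 0 < r ->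
  (forall x, 0 < nrm x <= r -> exists l, cderiv f (a + x) l) ->
  (forall e : R, 0 < e -> exists2 d : R, 0 < d &
     forall x, nrm x < d -> nrm (f (a + x) - f a) <= e) ->
  (forall x, nrm x = r -> nrm (f (a + x)) <= M) ->
  nrm (f a) <= M.
Proof.
move=> r0 fd fc fM; apply/ler_addgt0Pr => e e0.
have e2 : 0 < e / 2 by rewrite divr_gt0.
have [d d0 Hd] := fc _ e2.
pose s2 := ln r; pose s1 := ln (Num.min r (d / 2)).
have m0 : 0 < Num.min r (d / 2) by rewrite lt_min r0 divr_gt0.
have s12 : s1 <= s2 by rewrite ler_ln ?posrE// ge_min lexx.
have [|n0 H] := @circle_mean_indep f a s1 s2 s12 _ _ e2.
  by move=> x; rewrite lnK//; exact: fd.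
have {}H := H n0 (leqnn _).
have H2 : nrm (circle_mean f a s2 n0) <= M.
  by apply: nrm_circle_mean => x; rewrite lnK//; exact: fM.
have H1 : nrm (circle_mean f a s1 n0 - f a) <= e / 2.
  have -> : circle_mean f a s1 n0 - f a = circle_mean (fun z => f z - f a) a s1 n0.
    by rewrite /circle_mean sumrB mulrBr sum_cst_over.
  apply: nrm_circle_mean => x; rewrite lnK// => xm; apply: Hd.
  by rewrite xm gt_min ltr_pdivrMr// ltr_pMr// ltr1n orbT.
have -> : f a = - (circle_mean f a s1 n0 - f a) -
  (circle_mean f a s2 n0 - circle_mean f a s1 n0) + circle_mean f a s2 n0 by ring.
have := nrmD (- (circle_mean f a s1 n0 - f a) -
  (circle_mean f a s2 n0 - circle_mean f a s1 n0)) (circle_mean f a s2 n0).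
have := nrmD (- (circle_mean f a s1 n0 - f a)) (-
  (circle_mean f a s2 n0 - circle_mean f a s1 n0)).
rewrite !nrmN; lra.
Qed.

(** This is [max_center] for the difference quotient of [f] at [a], whose
  extension by [l] is continuous at [a]. *)
Lemma cauchy_estimate f a l (r K : R) : 0 < r ->
  (forall x, nrm x <= r -> exists k, cderiv f (a + x) k) ->
  cderiv f a l ->
  (forall x, nrm x = r -> nrm (f (a + x) - f a) <= K) ->
  nrm l <= K / r.
Proof.
move=> r0 fd fl fK.
pose g z := if z == a then l else (f z - f a) / (z - a).
have ga : g a = l by rewrite /g eqxx.
have gx x : x != 0 -> g (a + x) = (f (a + x) - f a) / x.
  by move=> x0; rewrite /g -subr_eq0 addrAC subrr add0r (negPf x0).
rewrite -ga; apply: (max_center (r := r)) => //.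
- move=> x /andP[x0 xr]; rewrite nrm_gt0 in x0.
  have [k Hk] := fd x xr; eexists.
  apply: (cderiv_near (f := fun z => (f z - f a) / (z - a)) (d := nrm x)).
  + by rewrite nrm_gt0.
  + move=> w wx; rewrite /g; case: eqVneq => // wa.
    by move: wx; rewrite wa opprD addrA subrr add0r nrmN ltxx.
  + apply: cderivM; first exact: cderivB Hk (cderiv_cst _ _).
    apply: cderivV; last exact: cderivB (cderiv_id _) (cderiv_cst _ _).
    by rewrite addrAC subrr add0r.
- move=> e e0; have [d d0 H] := fl _ e0; exists d => // x xd.
  have [->|x0] := eqVneq x 0; first by rewrite addr0 subrr nrm0 ltW.
  rewrite ga gx// -(ler_pM2r (_ : 0 < nrm x)) ?nrm_gt0// -nrmM.
  have := H (a + x); rewrite addrAC subrr add0r => /(_ xd).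
  by congr (nrm _ <= _); field.
- move=> x xr; have x0 : x != 0 by rewrite -nrm_gt0 xr.
  by rewrite gx// nrmM nrmV xr ler_pM2r ?invr_gt0// fK.
Qed.

End CauchyEstimate.

(** * Derivatives of differentiable functions are differentiable *)

Section Smoothness.
Variable R : realType.
Local Notation C := (R[i] : numFieldType).
Implicit Types (f g df : C -> C) (x y z w a : C).

(** Makes the real mean value theorem available for components of complex
  functions. *)
Lemma is_derive_of_bound (f : R -> R) (x l : R) :
  (forall e : R, 0 < e -> exists2 d : R, 0 < d & forall h, `|h| < d ->
    `|f (h + x) - f x - l * h| <= e * `|h|) -> is_derive x 1 f l.
Proof.
move=> D.
have cv : (h^-1 *: (f (h *: (1 : R) + x) - f x) @[h --> (0 : R)^'] --> (l : R)).
  apply/cvgrPdist_le => /= e /D[d d0 H].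
  rewrite near_withinE; apply/nbhs_ballP; exists d => //= h.
  rewrite -ball_normE /= sub0r normrN => hd h0.
  have := H h hd; rewrite /GRing.scale/= mulr1 => le.
  rewrite -(@ler_pM2r _ `|h|) ?normr_gt0// -normrM.
  apply: le_trans le; rewrite -[leLHS]normrN le_eqVlt; apply/orP; left; apply/eqP.
  by congr `|_|; field.
split; first by apply/cvg_ex; exists l.
exact: cvg_lim cv.
Qed.

(** Real mean value theorem for the component of [f] in the direction of
  [f x - f y], minus [psi]. A bound that varies with [t] is needed to gain a
  factorial from repeated integration. *)
Lemma mean_value_ineq f df x y (psi dpsi : R -> R) :
  (forall t : R, 0 <= t <= 1 ->
     cderiv f (y + t%:C%C * (x - y)) (df (y + t%:C%C * (x - y)))) ->
  (forall t : R, is_derive t 1 psi (dpsi t)) ->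
  (forall t : R, 0 <= t <= 1 ->
     nrm (df (y + t%:C%C * (x - y))) * nrm (x - y) <= dpsi t) ->
  nrm (f x - f y) <= psi 1 - psi 0.
Proof.
move=> fd pd bd.
have [->|D0] := eqVneq (f x - f y) 0.
  rewrite nrm0.
  have [|t ht] := @MVT_segment R psi dpsi 0 1 ler01 (fun t _ => pd t).
    by apply: derivable_within_continuous => t _; exact: ex_derive.
  rewrite subr0 mulr1 => ->; apply: le_trans (bd t _); first by rewrite mulr_ge0 ?nrm_ge0.
  by move: ht; rewrite in_itv.
pose D := f x - f y.
pose p (t : R) := y + t%:C%C * (x - y).
pose phi t := Re (conjc D * f (p t)).
have phid (t : R) : 0 <= t <= 1 -> is_derive t 1 phi (Re (conjc D * (df (p t) * (x - y)))).
  move=> ht; apply: is_derive_of_bound => e e0.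
  pose n := nrm D * nrm (x - y) + 1.
  have n0 : 0 < n by rewrite ltr_wpDl// mulr_ge0 ?nrm_ge0.
  have [d d0 H] := fd t ht (e / n) (divr_gt0 e0 n0).
  have m0 : 0 < nrm (x - y) + 1 by rewrite ltr_wpDl// nrm_ge0.
  exists (d / (nrm (x - y) + 1)); first by rewrite divr_gt0.
  move=> h; rewrite ltr_pdivlMr// => hd.
  have hp : p (h + t) - p t = h%:C%C * (x - y).
    by rewrite /p rmorphD/=; ring.
  have := H (p (h + t)); rewrite -/(p t) hp nrmM nrmR.
  have hle : `|h| * nrm (x - y) < d.
    by rewrite (le_lt_trans _ hd)// ler_wpM2l// lerDl.
  move=> /(_ hle) le.
  set A := f _ - _ - _ in le.
  have -> : phi (h + t) - phi t - Re (conjc D * (df (p t) * (x - y))) * h =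
      Re (conjc D * A).
    rewrite /phi /A -!raddfB/=.
    have -> (c : C) : Re c * h = Re (c * h%:C%C).
      by case: (c) => u v /=; rewrite mulr0 subr0.
    by rewrite -raddfB/=; congr Re; ring.
  rewrite (le_trans (nrm_Re _))// nrmM.
  have -> : nrm (conjc D) = nrm D.
    by apply: complexI; rewrite -!nrmE normcJ.
  have := ler_wpM2l (nrm_ge0 D) le => /le_trans; apply.
  rewrite [leLHS](_ : _ = e * `|h| * ((nrm D * nrm (x - y)) / n)); last first.
    by field; rewrite lt0r_neq0.
  rewrite -[leRHS]mulr1 ler_wpM2l ?mulr_ge0 ?(ltW e0)//.
  by rewrite ler_pdivrMr// mul1r lerDl.
pose F t := phi t - nrm D * psi t.
have Fd (t : R) : 0 <= t <= 1 -> is_derive t 1 F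
    (Re (conjc D * (df (p t) * (x - y))) - nrm D * dpsi t).
  move=> ht; have := phid t ht; have := pd t => h1 h2.
  apply: is_deriveB.
have Fd' (t : R) : t \in `]0, 1[ -> is_derive t 1 F
    (Re (conjc D * (df (p t) * (x - y))) - nrm D * dpsi t).
  by move=> ht; apply: Fd; move: ht; rewrite in_itv/= => /andP[/ltW-> /ltW->].
have [|t ht] := @MVT_segment R F
    (fun t => Re (conjc D * (df (p t) * (x - y))) - nrm D * dpsi t) 0 1 ler01 Fd'.
  apply: derivable_within_continuous => t ht.
  have {}ht : 0 <= t <= 1 by move: ht; rewrite in_itv.
  exact: (@ex_derive _ _ _ _ _ _ _ (Fd t ht)).
rewrite subr0 mulr1 => E.
have {}ht : 0 <= t <= 1 by move: ht; rewrite in_itv.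
have le : F 1 - F 0 <= 0.
  rewrite E subr_le0 (le_trans (ler_norm _))// (le_trans (nrm_Re _))// !nrmM.
  have -> : nrm (conjc D) = nrm D by apply: complexI; rewrite -!nrmE normcJ.
  by rewrite ler_wpM2l ?nrm_ge0// bd.
have e1 : p 1 = x by rewrite /p mul1r addrC subrK.
have e0 : p 0 = y by rewrite /p mul0r addr0.
have : phi 1 - phi 0 <= nrm D * (psi 1 - psi 0).
  by move: le; rewrite /F; lra.
rewrite /phi e1 e0 -raddfB/= -mulrBr -/D.
have -> : Re (conjc D * D) = nrm D * nrm D.
  apply: complexI; rewrite rmorphM/= -!nrmE -expr2 sqr_normc mulrC.
  by rewrite RRe_real// ger0_real// mulcJ_ge0.
by rewrite ler_pM2l// nrm_gt0.
Qed.

Lemma lipschitz_ineq f df x y (K : R) :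
  (forall t : R, 0 <= t <= 1 ->
     cderiv f (y + t%:C%C * (x - y)) (df (y + t%:C%C * (x - y)))) ->
  (forall t : R, 0 <= t <= 1 -> nrm (df (y + t%:C%C * (x - y))) <= K) ->
  nrm (f x - f y) <= K * nrm (x - y).
Proof.
move=> fd bd.
have := @mean_value_ineq f df x y (fun t => K * nrm (x - y) * t) (fun=> K * nrm (x - y)) fd.
rewrite mulr1 mulr0 subr0; apply.
  move=> t; apply: is_derive_of_bound => e e0; exists 1 => // h _.
  rewrite [X in `|X|](_ : _ = 0); last by ring.
  by rewrite normr0 mulr_ge0// ltW.
by move=> t ht; rewrite ler_wpM2r ?nrm_ge0// bd.
Qed.

Lemma segment_in_ball a x y (r : R) (t : R) : 0 <= t <= 1 ->
  nrm (x - a) < r -> nrm (y - a) < r -> nrm (y + t%:C%C * (x - y) - a) < r.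
Proof.
move=> /andP[t0 t1] xr yr.
have -> : y + t%:C%C * (x - y) - a = (1 - t)%:C%C * (y - a) + t%:C%C * (x - a).
  by rewrite rmorphB/=; ring.
rewrite (le_lt_trans (nrmD _ _))// !nrmM !nrmR !ger0_norm ?subr_ge0//.
have := ler_wpM2l t0 (ltW xr); have : 0 <= 1 - t by rewrite subr_ge0.
move=> /ler_wpM2l /(_ _ _ (ltW yr)).
have [->|tn0] := eqVneq t 0; first by rewrite subr0 !mul1r mul0r; lra.
have tp : 0 < t by rewrite lt_neqAle eq_sym tn0.
have : t * nrm (x - a) < t * r by rewrite ltr_pM2l.
lra.
Qed.

(** For a real-valued [D] the intervals of radius [K * nrm h] around [D h] meet
  pairwise, and the supremum of their left ends is the limit; the complex case
  follows by components. *)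
Lemma limit_at_zero (S : set C) (D : C -> C) (K : R) : S !=set0 ->
  (forall h k, S h -> S k -> nrm (D h - D k) <= K * (nrm h + nrm k)) ->
  exists l, forall h, S h -> nrm (D h - l) <= 2 * K * nrm h.
Proof.
move=> [h0 Sh0] HD.
have L (u : C -> R) : (forall h k, S h -> S k -> `|u h - u k| <= K * (nrm h + nrm k)) ->
    exists l, forall h, S h -> `|u h - l| <= K * nrm h.
  move=> Hu.
  have hs : has_sup [set u h - K * nrm h | h in S].
    split; first by exists (u h0 - K * nrm h0); exists h0.
    exists (u h0 + K * nrm h0) => _ [k Sk <-].
    by have := Hu _ _ Sk Sh0; rewrite ler_norml => /andP[]; lra.
  exists (sup [set u h - K * nrm h | h in S]) => h Sh.
  have h1 : u h - K * nrm h <= sup [set u h - K * nrm h | h in S].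
    by apply: ub_le_sup; [exact: hs.2|exists h].
  have h2 : sup [set u h - K * nrm h | h in S] <= u h + K * nrm h.
    apply: ge_sup; [exact: hs.1|move=> _ [k Sk <-]].
    by have := Hu _ _ Sk Sh; rewrite ler_norml => /andP[]; lra.
  by rewrite ler_norml; lra.
have [|lr Hr] := L (fun h => Re (D h)).
  move=> h k Sh Sk; rewrite (le_trans _ (HD h k Sh Sk))// -raddfB; exact: nrm_Re.
have [|li Hi] := L (fun h => Im (D h)).
  move=> h k Sh Sk; rewrite (le_trans _ (HD h k Sh Sk))// -raddfB; exact: nrm_Im.
exists (lr +i* li)%C => h Sh.
rewrite (le_trans (nrm_le_ReIm _))//.
have -> : Re (D h - (lr +i* li)%C) = Re (D h) - lr by case: (D h).
have -> : Im (D h - (lr +i* li)%C) = Im (D h) - li by case: (D h).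
have := Hr h Sh; have := Hi h Sh; lra.
Qed.

(** Three Cauchy estimates. For [f] itself: the derivative is bounded, hence
  [f] is Lipschitz. For [f (z + h) - f z]: the derivative is Lipschitz, hence
  the difference quotients converge to it uniformly and at a linear rate. For
  the difference of two difference quotients: those of the derivative converge
  at [a]. *)
Lemma derive1_cderiv f a (r : R) : 0 < r ->
  (forall z, nrm (z - a) < r -> exists l, cderiv f z l) ->
  exists k, cderiv (derive1 f) a k.
Proof.
move=> r0 fd.
have fd' z : nrm (z - a) < r -> cderiv f z (derive1 f z).
  by move=> /fd[l Hl]; rewrite (cderiv_derive1 Hl).
have [rho [rho0 rhor Hrho]] : exists rho : R, [/\ 0 < rho, rho <= r &
    forall z, nrm (z - a) < rho -> nrm (f z - f a) <= 1].
  have [|l Hl] := fd a; first by rewrite subrr nrm0.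
  have [d d0 H] := cderiv_cont Hl ltr01.
  exists (Num.min d r); split; first by rewrite lt_min d0.
    by rewrite ge_min lexx orbT.
  by move=> z; rewrite lt_min => /andP[/H].
have tri (x y z : C) : nrm (x - z) <= nrm (x - y) + nrm (y - z).
  by rewrite (le_trans _ (nrmD _ _))// addrA subrK.
(* Sixteenths leave room for the nested discs of radius 8, 2 and 1 times [q]. *)
pose q := rho / 16.
have q0 : 0 < q by rewrite divr_gt0.
have rq : rho = 16 * q by rewrite /q; field.
have addx (z x : C) : nrm (z + x - a) <= nrm (z - a) + nrm x.
  by rewrite (le_trans _ (nrmD _ _))// addrAC.
pose K1 := 2 / (4 * q).
have b1 z : nrm (z - a) <= 8 * q -> nrm (derive1 f z) <= K1.
  move=> zq; apply: (cauchy_estimate (f := f) (a := z)).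
  - by rewrite mulr_gt0.
  - move=> x xq; apply: fd.
    rewrite (le_lt_trans (addx _ _))//; apply: lt_le_trans rhor; lra.
  - by apply: fd'; apply: lt_le_trans rhor; lra.
  - move=> x xq.
    have h1 : nrm (f (z + x) - f a) <= 1.
      by apply: Hrho; rewrite (le_lt_trans (addx _ _))//; lra.
    have h2 : nrm (f a - f z) <= 1 by rewrite nrmB; apply: Hrho; lra.
    by rewrite (le_trans (tri _ (f a) _))//; lra.
have K10 : 0 <= K1 by rewrite divr_ge0// mulr_ge0// ltW.
have b2 z w : nrm (z - a) < 8 * q -> nrm (w - a) < 8 * q ->
    nrm (f z - f w) <= K1 * nrm (z - w).
  move=> zq wq; apply: (lipschitz_ineq (df := derive1 f)) => t ht.
    apply: fd'; have := segment_in_ball ht zq wq => /lt_le_trans; apply.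
    by apply: le_trans rhor; lra.
  by apply: b1; exact: ltW (segment_in_ball ht zq wq).
pose K2 := 2 * K1 / (2 * q).
have K20 : 0 <= K2 by rewrite divr_ge0// mulr_ge0// ltW.
have b3 z h : nrm (z - a) <= 2 * q -> nrm h <= 2 * q ->
    nrm (derive1 f (z + h) - derive1 f z) <= K2 * nrm h.
  move=> zq hq.
  have -> : K2 * nrm h = (2 * K1 * nrm h) / (2 * q).
    by rewrite /K2; field; rewrite lt0r_neq0.
  have sh w k : cderiv f (w + h) k -> cderiv (fun x => f (x + h)) w k.
    move=> H; rewrite -[k](_ : k * (1 + 0) = k); last by rewrite addr0 mulr1.
    apply: (cderiv_comp (g := fun x => x + h)) H.
    exact: cderivD (cderiv_id _) (cderiv_cst _ _).
  apply: (cauchy_estimate (f := fun x => f (x + h) - f x) (a := z)).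
  - by rewrite mulr_gt0.
  - move=> x xq; eexists; apply: cderivB; [apply: sh|]; apply: fd'.
      have := addx (z + x) h; have := addx z x; move=> A B.
      by apply: lt_le_trans rhor; lra.
    by have := addx z x; move=> A; apply: lt_le_trans rhor; lra.
  - apply: cderivB; [apply: sh|]; apply: fd'.
      by have := addx z h; move=> A; apply: lt_le_trans rhor; lra.
    by apply: lt_le_trans rhor; lra.
  - move=> x xq.
    have A := addx z x; have B := addx (z + x) h; have D := addx z h.
    have h1 : nrm (f (z + x + h) - f (z + x)) <= K1 * nrm h.
      have := b2 (z + x + h) (z + x); rewrite [z + x + h]addrC addrK addrC; apply; lra.
    have h2 : nrm (f (z + h) - f z) <= K1 * nrm h.
      have := b2 (z + h) z; rewrite [z + h]addrC addrK addrC; apply; lra.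
    by rewrite (le_trans (nrmD _ _))// nrmN; lra.
have b4 z h : nrm (z - a) <= 2 * q -> nrm h <= 2 * q ->
    nrm (f (z + h) - f z - derive1 f z * h) <= K2 * nrm h * nrm h.
  move=> zq hq.
  have := @lipschitz_ineq (fun x => f x - derive1 f z * x)
    (fun x => derive1 f x - derive1 f z) (z + h) z (K2 * nrm h).
  have -> : z + h - z = h by ring.
  have -> : f (z + h) - derive1 f z * (z + h) - (f z - derive1 f z * z) =
    f (z + h) - f z - derive1 f z * h by ring.
  have th t : 0 <= t <= 1 -> nrm (t%:C%C * h) <= nrm h.
    move=> /andP[t0 t1]; rewrite nrmM nrmR ger0_norm// -[leRHS]mul1r.
    by rewrite ler_wpM2r ?nrm_ge0.
  apply => t ht; have {}th := th t ht.
    rewrite -[X in cderiv _ _ (_ - X)](_ : 0 * (z + t%:C%C * h) + derive1 f z * 1 = _);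
      last by rewrite mul0r add0r mulr1.
    apply: cderivB; last exact: cderivM (cderiv_cst _ _) (cderiv_id _).
    apply: fd'; have := addx z (t%:C%C * h); move=> A.
    by apply: lt_le_trans rhor; lra.
  rewrite (le_trans (b3 _ _ zq (le_trans th hq)))//.
  by rewrite ler_wpM2l.
pose S := [set h : C | h != 0 /\ nrm h < q].
pose Df h := (derive1 f (a + h) - derive1 f a) / h.
pose K3 := 2 * K2 / q.
have HD h k : S h -> S k -> nrm (Df h - Df k) <= K3 * (nrm h + nrm k).
  move=> [h0 hq] [k0 kq].
  have -> : K3 * (nrm h + nrm k) = (2 * (K2 * nrm h + K2 * nrm k)) / q.
    by rewrite /K3; field; rewrite lt0r_neq0.
  pose Q h z := (f (z + h) - f z) / h.
  have Qd u z : u != 0 -> nrm u < q -> nrm (z - a) <= q ->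
      cderiv (Q u) z ((derive1 f (z + u) - derive1 f z) / u).
    move=> u0 uq zq.
    rewrite -[X in cderiv _ _ X](_ :
      (derive1 f (z + u) - derive1 f z) / u + (f (z + u) - f z) * 0 = _);
      last by rewrite mulr0 addr0.
    apply: (cderivM (f := fun x => f (x + u) - f x) (g := fun=> u^-1));
      last exact: cderiv_cst.
    apply: cderivB; last first.
      by apply: fd'; apply: lt_le_trans rhor; lra.
    rewrite -[X in cderiv _ _ X](_ :
      derive1 f (z + u) * (1 + 0) = _); last by rewrite addr0 mulr1.
    apply: (cderiv_comp (g := fun x => x + u)).
      exact: cderivD (cderiv_id _) (cderiv_cst _ _).
    apply: fd'; have := addx z u; move=> A.
    by apply: lt_le_trans rhor; lra.
  have Qb u z : u != 0 -> nrm u < q -> nrm (z - a) <= q ->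
      nrm (Q u z - derive1 f z) <= K2 * nrm u.
    move=> u0 uq zq.
    rewrite -(ler_pM2r (_ : 0 < nrm u)) ?nrm_gt0// -nrmM.
    have -> : (Q u z - derive1 f z) * u = f (z + u) - f z - derive1 f z * u.
      by rewrite /Q; field.
    by apply: b4; lra.
  have aa : nrm (a - a) <= q by rewrite subrr nrm0 ltW.
  apply: (cauchy_estimate (f := fun z => Q h z - Q k z) (a := a)) => //.
  - move=> x xq; have xa : nrm (a + x - a) <= q by rewrite addrAC subrr add0r.
    by eexists; apply: cderivB; apply: Qd.
  - by apply: cderivB; apply: Qd.
  - have E z : nrm (z - a) <= q -> nrm (Q h z - Q k z) <= K2 * nrm h + K2 * nrm k.
      move=> zq; rewrite (le_trans (tri _ (derive1 f z) _))// lerD ?Qb//.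
      by rewrite nrmB Qb.
    move=> x xq; have xa : nrm (a + x - a) <= q by rewrite addrAC subrr add0r xq.
    rewrite (le_trans (nrmD _ _))// nrmN; have := E _ xa; have := E _ aa; lra.
have S0 : S !=set0.
  exists ((q / 2)%:C%C); split.
    by rewrite -nrm_gt0 nrmR normr_gt0 lt0r_neq0// divr_gt0.
  by rewrite nrmR ger0_norm ?divr_ge0 ?ltW//; lra.
have [l Hl] := limit_at_zero S0 HD.
exists l => e e0.
have K30 : 0 <= K3 by apply: divr_ge0; [exact: mulr_ge0|exact: ltW].
have K31 : 0 < 2 * K3 + 1 by rewrite ltr_wpDl// mulr_ge0.
exists (Num.min q (e / (2 * K3 + 1))); first by rewrite lt_min q0 divr_gt0.
move=> w; rewrite lt_min => /andP[wq]; rewrite ltr_pdivlMr// => we.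
have [->|wa] := eqVneq w a; first by rewrite !subrr mulr0 subr0 nrm0 mulr0.
have := Hl (w - a); rewrite /S/= subr_eq0 => /(_ (conj wa wq)).
have wE : a + (w - a) = w by rewrite addrC subrK.
rewrite /Df wE => le.
have wa0 : w - a != 0 by rewrite subr_eq0.
have -> : derive1 f w - derive1 f a - l * (w - a) =
  ((derive1 f w - derive1 f a) / (w - a) - l) * (w - a).
  by rewrite mulrBl divfK.
rewrite nrmM ler_wpM2r ?nrm_ge0// (le_trans le)//.
have := nrm_ge0 (w - a); lra.
Qed.

End Smoothness.

(** * Zeros of holomorphic and meromorphic functions *)

Section Holomorphic.
Variable R : realType.
Local Notation C := (R[i] : numFieldType).
Implicit Types (f g df : C -> C) (x y z w a : C) (U : set C).

Definition cdisc a (r : R) : set C := [set z | nrm (z - a) < r].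

Lemma open_cdisc a r : open (cdisc a r).
Proof.
rewrite openE => z /= zr; apply/nearC; exists (r - nrm (z - a)); first by rewrite subr_gt0.
move=> w wz; rewrite /cdisc/= -[w](subrK z) -addrA (le_lt_trans (nrmD _ _))//.
by rewrite -ltrBrDr.
Qed.

Lemma open_disc_in U z : open U -> U z -> exists2 d : R, 0 < d & cdisc z d `<=` U.
Proof.
by rewrite openE => oU /oU /nearC[d d0 H]; exists d => // w /H.
Qed.

Definition holomorphic_on U f := forall z, U z -> exists l, cderiv f z l.

Lemma hol_cderiv U f z : holomorphic_on U f -> U z -> cderiv f z (derive1 f z).
Proof. by move=> /[apply] -[l Hl]; rewrite (cderiv_derive1 Hl). Qed.

Lemma hol_derive1 U f : open U -> holomorphic_on U f -> holomorphic_on U (derive1 f).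
Proof.
move=> oU Hf z /(open_disc_in oU)[d d0 dU].
by apply: derive1_cderiv d0 _ => w /dU /Hf.
Qed.

Lemma hol_derive1n U f k : open U -> holomorphic_on U f ->
  holomorphic_on U (derive1n k f).
Proof. by move=> oU Hf; elim: k => // k; exact: hol_derive1. Qed.

(** Derivatives are local, so that functions may be replaced on an open set. *)
Lemma derive1n_eq_on U f g k z : open U -> {in U, f =1 g} -> U z ->
  derive1n k f z = derive1n k g z.
Proof.
move=> oU fg; elim: k z => [|k IH] z Uz; first by apply: fg; rewrite inE.
rewrite !derive1nS !derive1E; apply: near_eq_derive.
have [d d0 dU] := open_disc_in oU Uz.
by apply/nearC; exists d => // w /dU /IH.
Qed.

Lemma hol_eq_on U f g : open U -> {in U, f =1 g} ->
  holomorphic_on U f -> holomorphic_on U g.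
Proof.
move=> oU fg Hf z Uz; have [l Hl] := Hf z Uz; have [d d0 dU] := open_disc_in oU Uz.
by exists l; apply: cderiv_near d0 _ Hl => w /dU Uw; rewrite fg// inE.
Qed.

Lemma sub_hol U V f : V `<=` U -> holomorphic_on U f -> holomorphic_on V f.
Proof. by move=> VU Hf z /VU /Hf. Qed.

Lemma hol_cst U c : holomorphic_on U (fun=> c).
Proof. by move=> z _; exists 0; exact: cderiv_cst. Qed.

Lemma holD U f g : holomorphic_on U f -> holomorphic_on U g ->
  holomorphic_on U (fun z => f z + g z).
Proof.
move=> Hf Hg z Uz; have [l Hl] := Hf z Uz; have [k Hk] := Hg z Uz.
by exists (l + k); exact: cderivD.
Qed.

Lemma holM U f g : holomorphic_on U f -> holomorphic_on U g ->
  holomorphic_on U (fun z => f z * g z).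
Proof.
move=> Hf Hg z Uz; have [l Hl] := Hf z Uz; have [k Hk] := Hg z Uz.
by eexists; exact: cderivM Hl Hk.
Qed.

Lemma holV U f : (forall z, U z -> f z != 0) -> holomorphic_on U f ->
  holomorphic_on U (fun z => (f z)^-1).
Proof.
move=> f0 Hf z Uz; have [l Hl] := Hf z Uz.
by eexists; apply: cderivV Hl; exact: f0.
Qed.

Lemma hol_sum U (I : Type) (r : seq I) (P : pred I) (F : I -> C -> C) :
  (forall i, P i -> holomorphic_on U (F i)) ->
  holomorphic_on U (fun z => \sum_(i <- r | P i) F i z).
Proof.
move=> HF; elim: r => [|i r IH].
  by under eq_fun do rewrite big_nil; exact: hol_cst.
under eq_fun do rewrite big_cons.
have [Pi|_] := boolP (P i); last exact: IH.
by apply: holD => //; exact: HF.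
Qed.

Lemma hol_prod U (I : Type) (r : seq I) (P : pred I) (F : I -> C -> C) :
  (forall i, P i -> holomorphic_on U (F i)) ->
  holomorphic_on U (fun z => \prod_(i <- r | P i) F i z).
Proof.
move=> HF; elim: r => [|i r IH].
  by under eq_fun do rewrite big_nil; exact: hol_cst.
under eq_fun do rewrite big_cons.
have [Pi|_] := boolP (P i); last exact: IH.
by apply: holM => //; exact: HF.
Qed.

Lemma hol_det U n (A : C -> 'M[C]_n) :
  (forall i j, holomorphic_on U (fun z => A z i j)) ->
  holomorphic_on U (fun z => \det (A z)).
Proof.
move=> HA; apply: hol_sum => s _; apply: holM; first exact: hol_cst.
by apply: hol_prod => i _; exact: HA.
Qed.

(** Integration of the bound [B * nrm (z - a) ^+ j / j!] along the segment from
  [a]. *)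
Lemma taylor_step f df a (r B : R) j :
  (forall z, cdisc a r z -> cderiv f z (df z)) -> f a = 0 ->
  (forall z, cdisc a r z -> nrm (df z) <= B * nrm (z - a) ^+ j / j`!%:R) ->
  forall z, cdisc a r z -> nrm (f z) <= B * nrm (z - a) ^+ j.+1 / j.+1`!%:R.
Proof.
move=> fd fa bd z zr.
have r0 : 0 < r by rewrite (le_lt_trans (nrm_ge0 _) zr).
have ar : nrm (a - a) < r by rewrite subrr nrm0.
pose K := B * nrm (z - a) ^+ j.+1 / j`!%:R.
have fact0 (m : nat) : (m`!%:R : R) != 0 by rewrite pnatr_eq0 -lt0n fact_gt0.
pose L := B * nrm (z - a) ^+ j.+1 / j.+1`!%:R.
have LK : L * j.+1%:R = K.
  by rewrite /L factS natrM invfM mulrA mulrAC divfK// pnatr_eq0.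
have := @mean_value_ineq R f df z a (fun t => L * t ^+ j.+1) (fun t => K * t ^+ j).
rewrite fa subr0 expr1n mulr1 expr0n mulr0 subr0; apply.
- by move=> t ht; apply: fd; exact: segment_in_ball ht zr ar.
- move=> t.
  have D := @is_deriveX R R^o id j.+1 t 1 1 (is_derive_id _ _).
  have := @is_deriveZ R R^o R^o (id ^+ j.+1) L t 1 _ D.
  rewrite (_ : _ \*: _ = (fun t => L * t ^+ j.+1)); last first.
    by apply/funext => s; rewrite /GRing.scale/= fctE.
  by move=> D'; apply: is_derive_eq D' _; rewrite /GRing.scale/= mulr1 mulrA LK.
- move=> t /andP[t0 t1].
  have := bd _ (segment_in_ball (introT andP (conj t0 t1)) zr ar).
  rewrite addrAC subrr add0r nrmM nrmR ger0_norm// exprMn => le.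
  have := ler_wpM2r (nrm_ge0 (z - a)) le; congr (_ <= _).
  by rewrite /K exprS; field.
Qed.

(** Both sides are compared with the falling factorial of [2 n], which is
  'C(2 n, n) * n!. *)
Lemma expn_le_fact n : (n ^ n <= 4 ^ n * n`!)%N.
Proof.
have h : (n ^ n <= (n + n) ^_ n)%N.
  suff H m : (m <= n)%N -> (n ^ m <= (n + n) ^_ m)%N by exact: H.
  elim: m => [//|m IH] mn; rewrite expnSr ffactnSr leq_mul ?IH ?(ltnW mn)//.
  by rewrite -addnBA ?leq_addr// ltnW.
rewrite (leq_trans h)// -bin_ffact leq_mul2r; apply/orP; right.
rewrite (_ : 4 = 2 ^ 2)%N// -expnM mul2n -addnn (expnDn 1 1).
have nn : (n < (n + n).+1)%N by rewrite ltnS leq_addr.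
by rewrite (bigD1 (Ordinal nn))//= !exp1n !muln1 leq_addr.
Qed.

(** One Cauchy estimate per derivative, with the available room [r / 4] shared
  equally among the [n] circles. *)
Lemma derive1n_bound f a (r M : R) n : 0 < r -> (0 < n)%N ->
  holomorphic_on (cdisc a r) f -> (forall z, cdisc a r z -> nrm (f z) <= M) ->
  forall z, cdisc a (r / 2) z -> nrm (derive1n n f z) <= M * (8 * n%:R / r) ^+ n.
Proof.
move=> r0 n0 Hf fM.
have nR : 0 < (n%:R : R) by rewrite ltr0n.
pose rho := r / (4 * n%:R).
have rho0 : 0 < rho by rewrite divr_gt0// mulr_gt0.
have rn : rho * n%:R = r / 4 by rewrite /rho; field; rewrite lt0r_neq0.
have oD := @open_cdisc a r.
have M0 : 0 <= M by apply: le_trans (nrm_ge0 _) (fM a _); rewrite /cdisc/= subrr nrm0.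
have H j : (j <= n)%N -> forall z, nrm (z - a) < 3 / 4 * r - j%:R * rho ->
    nrm (derive1n j f z) <= M * (2 / rho) ^+ j.
  elim: j => [|j IH] jn z.
    by rewrite mul0r subr0 expr0 mulr1 => zr; apply: fM; rewrite /cdisc/=; lra.
  have j0 : 0 <= j%:R * rho by rewrite mulr_ge0 ?ler0n ?(ltW rho0).
  rewrite -natr1 mulrDl mul1r => zr.
  have step x : nrm x <= rho -> nrm (z + x - a) < 3 / 4 * r - j%:R * rho.
    move=> xr; rewrite addrAC (le_lt_trans (nrmD _ _))//; lra.
  have dr x : nrm (x - a) < 3 / 4 * r - j%:R * rho -> cdisc a r x.
    by rewrite /cdisc/=; lra.
  rewrite derive1nS.
  have -> : M * (2 / rho) ^+ j.+1 = (M * (2 / rho) ^+ j + M * (2 / rho) ^+ j) / rho.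
    by rewrite exprS; field; rewrite lt0r_neq0.
  have z0 : nrm (z - a) < 3 / 4 * r - j%:R * rho by lra.
  apply: (cauchy_estimate (f := derive1n j f) (a := z)) => //.
  - by move=> x /step/dr; exact: (hol_derive1n j oD Hf).
  - by apply: (hol_cderiv (hol_derive1n j oD Hf)); exact: dr.
  - move=> x xr; rewrite (le_trans (nrmD _ _))// nrmN lerD ?IH ?(ltnW jn)//.
    by apply: step; rewrite xr.
move=> z zr.
have -> : 8 * n%:R / r = 2 / rho.
  by rewrite /rho; field; rewrite !lt0r_neq0.
apply: H => //; rewrite [n%:R * rho]mulrC rn; move: zr; rewrite /cdisc/=; lra.
Qed.

Lemma taylor_ineq (F : nat -> C -> C) a (r B : R) n :
  (forall j z, (j < n)%N -> cdisc a r z -> cderiv (F j) z (F j.+1 z)) ->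
  (forall j, (j < n)%N -> F j a = 0) ->
  (forall z, cdisc a r z -> nrm (F n z) <= B) ->
  forall z, cdisc a r z -> nrm (F 0%N z) <= B * nrm (z - a) ^+ n / n`!%:R.
Proof.
move=> Fd Fa FB.
suff H j : (j <= n)%N -> forall z, cdisc a r z ->
    nrm (F (n - j)%N z) <= B * nrm (z - a) ^+ j / j`!%:R.
  by move=> z zr; have := H n (leqnn _) z zr; rewrite subnn.
elim: j => [_ z zr|j IH jn]; first by rewrite subn0 expr0 mulr1 divr1 FB.
have e : (n - j = (n - j.+1).+1)%N by rewrite subnSK.
have lt : (n - j.+1 < n)%N by rewrite ltn_subrL/= (leq_ltn_trans _ jn).
apply: (taylor_step (df := F (n - j)%N)).
- by move=> z zr; rewrite e; exact: Fd.
- exact: Fa.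
- exact: (IH (ltnW jn)).
Qed.

Lemma bounded_near U f a : open U -> holomorphic_on U f -> U a ->
  exists r M : R, [/\ 0 < r, cdisc a r `<=` U & forall z, cdisc a r z -> nrm (f z) <= M].
Proof.
move=> oU Hf Ua; have [d d0 dU] := open_disc_in oU Ua; have [l Hl] := Hf a Ua.
have [d' d'0 H] := cderiv_cont Hl ltr01.
exists (Num.min d d'), (nrm (f a) + 1); split; first by rewrite lt_min d0.
  by move=> z; rewrite /cdisc/= lt_min => /andP[/dU].
move=> z; rewrite /cdisc/= lt_min => /andP[_ /H h].
by rewrite -(subrK (f a) (f z)) (le_trans (nrmD _ _))// addrC lerD.
Qed.

(** Taylor's inequality and [derive1n_bound] bound [nrm (f z)] by
  [M * (8 n / r * nrm (z - a)) ^ n / n!], which [expn_le_fact] bounds by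
  [M * (32 * nrm (z - a) / r) ^ n]; for [nrm (z - a) < r / 64] this tends to
  0. *)
Lemma flat_zero U f a : open U -> holomorphic_on U f -> U a ->
  (forall n, derive1n n f a = 0) ->
  exists2 d : R, 0 < d & forall z, cdisc a d z -> f z = 0.
Proof.
move=> oU Hf Ua fa.
have [r [M [r0 rU fM]]] := bounded_near oU Hf Ua.
have Hr := sub_hol rU Hf.
exists (r / 64); first by rewrite divr_gt0.
move=> z zr; apply/eqP; rewrite -nrm_eq0 eq_le nrm_ge0 andbT.
have M0 : 0 <= M by apply: le_trans (nrm_ge0 _) (fM a _); rewrite /cdisc/= subrr nrm0.
have small n : (0 < n)%N -> nrm (f z) <= M / 2 ^+ n.
  move=> n0.
  have Hz := @taylor_ineq (fun j => derive1n j f) a (r / 2) _ n _ _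
    (derive1n_bound r0 n0 Hr fM) z.
  apply: (le_trans (Hz _ _ _)).
  - move=> j w _ wr; rewrite derive1nS; apply: (hol_cderiv (U := U)).
      exact: hol_derive1n.
    by apply: rU; move: wr; rewrite /cdisc/=; lra.
  - by move=> j _; exact: fa.
  - by move: zr; rewrite /cdisc/=; lra.
  rewrite -!mulrA ler_wpM2l// mulrA -exprMn.
  have f0 : 0 < (n`!%:R : R) by rewrite ltr0n fact_gt0.
  rewrite ler_pdivrMr// -(ler_pM2l (_ : 0 < 2 ^+ n)) ?exprn_gt0//.
  rewrite mulVKf ?expf_neq0 ?pnatr_eq0// -exprMn.
  apply: (@le_trans _ _ ((n%:R / 4) ^+ n)).
    have n0' : 0 <= (n%:R : R) by rewrite ler0n.
    have rV : 0 <= r^-1 by rewrite invr_ge0 ltW.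
    have h : 2 * (8 * (n%:R / r) * nrm (z - a)) <= n%:R / 4.
      rewrite [leLHS](_ : _ = n%:R * (16 * nrm (z - a) / r)); last by ring.
      rewrite ler_wpM2l// ler_pdivrMr//.
      by move: zr; rewrite /cdisc/=; lra.
    apply: lerXn2r h; rewrite nnegrE; last by rewrite divr_ge0.
    by rewrite !mulr_ge0// nrm_ge0.
  rewrite exprMn exprVn ler_pdivrMr ?exprn_gt0// mulrC -!natrX -natrM ler_nat.
  exact: expn_le_fact.
have [M00|Mn0] := eqVneq M 0.
  by have := small 1%N isT; rewrite M00 mul0r.
rewrite leNgt; apply/negP => fz.
have [k hk] : exists k, M / nrm (f z) < k%:R.
  by exists (Num.bound (M / nrm (f z))); rewrite archi_boundP// divr_ge0// nrm_ge0.
have := small k.+1 isT; rewrite leNgt => /negP; apply.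
rewrite ltr_pdivrMr ?exprn_gt0// mulrC -ltr_pdivrMr// (lt_trans hk)//.
by rewrite -natrX ltr_nat (leq_trans (ltn_expl k (isT : 1 < 2)%N))// leq_exp2l.
Qed.

Lemma cderivX_sub a m z : cderiv (fun x => (x - a) ^+ m.+1) z (m.+1%:R * (z - a) ^+ m).
Proof.
elim: m => [|m IH].
  rewrite expr0 mulr1 -[X in cderiv _ _ X](subr0 1).
  exact: cderivB (cderiv_id _) (cderiv_cst _ _).
have D : cderiv (fun x => x - a) z (1 - 0) := cderivB (cderiv_id _) (cderiv_cst _ _).
have := cderivM D IH; rewrite subr0 mul1r.
rewrite (_ : (fun x => _ * _) = (fun x => (x - a) ^+ m.+2)); last first.
  by apply/funext => x; rewrite [RHS]exprS.
by congr cderiv; rewrite -[m.+2%:R]natr1 [in RHS]exprS exprS; ring.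
Qed.

(** Near [a] the function differs from its leading Taylor term by at most half
  of that term. *)
Lemma nonflat_nonzero U f a n : open U -> holomorphic_on U f -> U a ->
  derive1n n f a != 0 -> (forall j, (j < n)%N -> derive1n j f a = 0) ->
  exists2 d : R, 0 < d & forall z, z != a -> cdisc a d z -> f z != 0.
Proof.
move=> oU Hf Ua; set c := derive1n n f a => c0 fa.
have Hn k := hol_derive1n k oU Hf.
have c20 : 0 < nrm c / 2 by rewrite divr_gt0// nrm_gt0.
have [d' d'0 Hd'] := cderiv_cont (hol_cderiv (Hn n) Ua) c20.
have [d'' d''0 dU] := open_disc_in oU Ua.
exists (Num.min d' d''); first by rewrite lt_min d'0.
have factC (m : nat) : (m`!%:R : C) != 0 by rewrite pnatr_eq0 -lt0n fact_gt0.
have factR (m : nat) : 0 < (m`!%:R : R) by rewrite ltr0n fact_gt0.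
pose F j z := derive1n j f z - c * ((z - a) ^+ (n - j) / (n - j)`!%:R).
have sub z : cdisc a (Num.min d' d'') z -> U z.
  by rewrite /cdisc/= lt_min => /andP[_ /dU].
move=> z za zr; apply/eqP => fz0.
have X0 : 0 < nrm (z - a) ^+ n / n`!%:R.
  by rewrite divr_gt0// exprn_gt0// nrm_gt0 subr_eq0.
have half : nrm c / 2 < nrm c by rewrite ltr_pdivrMr// ltr_pMr ?nrm_gt0// ltr1n.
have nF : nrm (F 0%N z) = nrm c * (nrm (z - a) ^+ n / n`!%:R).
  rewrite /F subn0 derive1n0 fz0 sub0r nrmN !nrmM nrmV nrmX.
  by rewrite -[in LHS](rmorph_nat (real_complex R)) nrmR ger0_norm ?ler0n.
suff : nrm (F 0%N z) <= nrm c / 2 * nrm (z - a) ^+ n / n`!%:R.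
  by rewrite nF -mulrA ler_pM2r// leNgt half.
apply: (taylor_ineq (r := Num.min d' d'') (n := n)) => //.
- move=> j w jn wr; rewrite /F.
  apply: cderivB; first by rewrite derive1nS; apply: hol_cderiv (Hn j) _; exact: sub.
  rewrite -[X in cderiv _ _ X](_ : 0 * ((w - a) ^+ (n - j) / (n - j)`!%:R) + c *
     (((n - j.+1).+1%:R * (w - a) ^+ (n - j.+1)) / (n - j)`!%:R +
      (w - a) ^+ (n - j) * 0) = _); last first.
    rewrite mul0r add0r mulr0 addr0 -(subnSK jn) factS natrM.
    by congr (_ * _); rewrite invfM mulrACA divff ?pnatr_eq0// mul1r.
  apply: cderivM; first exact: cderiv_cst.
  apply: cderivM; last exact: cderiv_cst.
  by rewrite -(subnSK jn); exact: cderivX_sub.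
- move=> j jn; rewrite /F fa// subrr expr0n subn_eq0 leqNgt jn/= mul0r mulr0 subr0//.
- move=> w; rewrite /cdisc/= lt_min => /andP[/Hd' + _].
  by rewrite /F subnn expr0 fact0 divr1 mulr1.
Qed.

Lemma zero_dichotomy U f a : open U -> holomorphic_on U f -> U a ->
  (exists2 d : R, 0 < d & forall z, cdisc a d z -> f z = 0) \/
  (exists2 d : R, 0 < d & forall z, z != a -> cdisc a d z -> f z != 0).
Proof.
move=> oU Hf Ua.
have [H|/existsNP H] := pselect (forall n, derive1n n f a = 0).
  by left; exact: (flat_zero oU Hf Ua H).
right; have ex : exists n, derive1n n f a != 0 by have [n /eqP hn] := H; exists n.
case: (ex_minnP ex) => n hn hmin.
apply: (nonflat_nonzero oU Hf Ua hn) => j jn; apply/eqP; apply: contraTT jn => hj.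
by rewrite -leqNgt hmin.
Qed.

(** By [zero_dichotomy] each point has a punctured neighbourhood on which [phi]
  vanishes identically or nowhere. Both kinds of points form open sets, and a
  segment joining points of different kinds would be disconnected. *)
Lemma mero_dichotomy (phi : C -> C) : meromorphic phi ->
  mero_eq phi (fun=> 0) \/ (forall z0, \forall z \near z0^', phi z != 0).
Proof.
move=> mphi.
pose A z0 := exists2 d : R, 0 < d & forall z, z != z0 -> cdisc z0 d z -> phi z = 0.
pose B z0 := exists2 d : R, 0 < d & forall z, z != z0 -> cdisc z0 d z -> phi z != 0.
have AB z0 : A z0 \/ B z0.
  have [n [g [/nearC[d1 d10 H1] /dnearC[d2 d20 H2]]]] := mphi z0.
  have Hg : holomorphic_on (cdisc z0 d1) g by move=> z /H1 /derivableC.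
  have zz : cdisc z0 d1 z0 by rewrite /cdisc/= subrr nrm0.
  have [[d d0 H]|[d d0 H]] := zero_dichotomy (@open_cdisc z0 d1) Hg zz.
    left; exists (Num.min d d2); first by rewrite lt_min d0.
    move=> z zz0; rewrite /cdisc/= lt_min => /andP[zd zd2].
    by rewrite H2// H// mul0r.
  right; exists (Num.min d d2); first by rewrite lt_min d0.
  move=> z zz0; rewrite /cdisc/= lt_min => /andP[zd zd2].
  by rewrite H2// mulf_neq0// ?H// invr_eq0 expf_neq0// subr_eq0.
have nAB z0 : A z0 -> B z0 -> False.
  move=> [d1 d10 H1] [d2 d20 H2].
  pose m := Num.min d1 d2 / 2.
  have m0 : 0 < m by rewrite divr_gt0// lt_min d10.
  have [m1 m2] : m < d1 /\ m < d2.
    by rewrite /m; have [] := leP d1 d2; lra.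
  have e : z0 + m%:C%C - z0 = m%:C%C by ring.
  have z0' : z0 + m%:C%C != z0.
    by rewrite -subr_eq0 e -nrm_gt0 nrmR normr_gt0 lt0r_neq0.
  have n (d : R) : m < d -> cdisc z0 d (z0 + m%:C%C).
    by move=> md; rewrite /cdisc/= e nrmR ger0_norm// ltW.
  by have := H2 _ z0' (n _ m2); rewrite H1 ?eqxx//; exact: n.
have open_near (P : C -> Prop) z0 (d : R) : 0 < d ->
    (forall z, z != z0 -> cdisc z0 d z -> P z) ->
    forall z, cdisc z0 d z ->
      exists2 d' : R, 0 < d' & forall w, w != z -> cdisc z d' w -> P w.
  move=> d0 H z zd; have [->|zz0] := eqVneq z z0; first by exists d.
  have [d' d'0 d'd] := open_disc_in (@open_cdisc z0 d) zd.
  exists (Num.min d' (nrm (z - z0))); first by rewrite lt_min d'0 nrm_gt0 subr_eq0.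
  move=> w wz; rewrite /cdisc/= lt_min => /andP[wd wz0]; apply: H; last exact: d'd.
  by apply: contraTneq wz0 => ->; rewrite nrmB ltxx.
have [[x Ax]|noA] := pselect (exists x, A x); last first.
  right=> z0; apply/dnearC; have [Az|//] := AB z0.
  by exfalso; apply: noA; exists z0.
left; move=> y; apply/dnearC; have [//|By] := AB y; exfalso.
pose p (t : R) := x + t%:C%C * (y - x).
pose T := [set t | 0 <= t <= 1 /\ A (p t)].
have p0 : p 0 = x by rewrite /p mul0r addr0.
have p1 : p 1 = y by rewrite /p mul1r addrC subrK.
have T0 : T 0 by split; rewrite ?p0// lexx ler01.
have hs : has_sup T by split; [exists 0|exists 1 => t [/andP[]]].
pose s := sup T.
have s0 : 0 <= s by apply: ub_le_sup; [exact: hs.2|].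
have s1 : s <= 1 by apply: ge_sup; [exact: hs.1|move=> t [/andP[]]].
have nyx : 0 < nrm (y - x) + 1 by rewrite ltr_wpDl// nrm_ge0.
have pc (d t : R) : 0 < d -> `|t - s| * (nrm (y - x) + 1) < d -> cdisc (p s) d (p t).
  move=> d0; rewrite /cdisc/=; apply: le_lt_trans.
  rewrite (_ : p t - p s = (t - s)%:C%C * (y - x)); last by rewrite /p rmorphB/=; ring.
  by rewrite nrmM nrmR ler_wpM2l// lerDl.
have [[d d0 H]|[d d0 H]] := AB (p s).
  have [s1'|] := eqVneq s 1; first by apply: (nAB y) By; rewrite -p1 -s1'; exists d.
  move=> sn1; have slt : s < 1 by rewrite lt_neqAle sn1.
  pose t := s + Num.min (1 - s) (d / (nrm (y - x) + 1) / 2).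
  have m0 : 0 < Num.min (1 - s) (d / (nrm (y - x) + 1) / 2).
    by rewrite lt_min subr_gt0 slt !divr_gt0.
  have Tt : T t.
    split.
      rewrite /t addr_ge0 ?(ltW m0)//= -lerBrDl ge_min lexx//.
    apply: (open_near _ _ _ d0 H); apply: pc => //.
    rewrite {1}/t [s + _ - s]addrAC subrr add0r gtr0_norm// -ltr_pdivlMr// gt_min; apply/orP; right.
    by rewrite ltr_pdivrMr// ltr_pMr ?divr_gt0// ltr1n.
  have : t <= s by apply: ub_le_sup; [exact: hs.2|].
  by rewrite /t gerDl leNgt m0.
have [t Tt ts] : exists2 t, T t & s - d / (nrm (y - x) + 1) < t.
  by apply: sup_gt; [exact: hs.1|rewrite ltrBlDr ltrDl divr_gt0].
have tle : t <= s by apply: ub_le_sup; [exact: hs.2|].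
apply: (nAB (p t) Tt.2); apply: (open_near _ _ _ d0 H); apply: pc => //.
rewrite ler0_norm ?subr_le0// opprB -ltr_pdivlMr//; lra.
Qed.

Lemma entire_dichotomy (f : C -> C) : holomorphic_on setT f ->
  (forall z, f z = 0) \/ (forall z0, \forall z \near z0^', f z != 0).
Proof.
move=> Hf; have mf : meromorphic f.
  move=> z0; exists 0%N, f; split.
    by apply/nearC; exists 1 => // z _; apply/derivableC; exact: Hf.
  by apply/dnearC; exists 1 => // z _ _; rewrite expr0 divr1.
have [f0|] := mero_dichotomy mf; last by right.
left=> z; have /dnearC[d d0 H] := f0 z.
have [[d' d'0 Hd]|[d' d'0 Hd]] := zero_dichotomy openT Hf (I : setT z).
  by apply: Hd; rewrite /cdisc/= subrr nrm0.
pose m := Num.min d d' / 2.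
have m0 : 0 < m by rewrite divr_gt0// lt_min d0.
have [m1 m2] : m < d /\ m < d' by rewrite /m; have [] := leP d d'; lra.
have e : z + m%:C%C - z = m%:C%C by ring.
have z' : z + m%:C%C != z by rewrite -subr_eq0 e -nrm_gt0 nrmR normr_gt0 lt0r_neq0.
have := Hd (z + m%:C%C) z'; rewrite /cdisc/= e nrmR ger0_norm ?(ltW m0)// => /(_ m2).
by rewrite H ?eqxx// e nrmR ger0_norm ?(ltW m0).
Qed.

End Holomorphic.

(** * The Wronskian of independent entire functions *)

Section Wronskian.
Variable R : realType.
Local Notation C := (R[i] : numFieldType).
Implicit Types (z w : C).

Definition wronskian_mx N (f : 'I_N -> C -> C) z : 'M[C]_N :=
  \matrix_(i, j) derive1n i (f j) z.

Lemma cderiv_sum_zero U (I : Type) (r : seq I) (F : I -> C -> C) z :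
  open U -> U z -> (forall i, holomorphic_on U (F i)) ->
  (forall w, U w -> \sum_(i <- r) F i w = 0) -> \sum_(i <- r) derive1 (F i) z = 0.
Proof.
move=> oU Uz HF F0.
have D : cderiv (fun x => \sum_(i <- r) F i x) z (\sum_(i <- r) derive1 (F i) z).
  by apply: cderiv_sum => i _; exact: hol_cderiv (HF i) Uz.
have [d d0 dU] := open_disc_in oU Uz.
apply: cderiv_uniq D _; apply: cderiv_near d0 _ (cderiv_cst 0 z) => w wd.
by rewrite F0//; exact: dU.
Qed.

(** The mean value inequality with bound 0. *)
Lemma constant_on_disc f a (r : R) z : holomorphic_on (cdisc a r) f ->
  (forall w, cdisc a r w -> derive1 f w = 0) -> cdisc a r z -> f z = f a.
Proof.
move=> Hf f0 zr; apply/eqP; rewrite -subr_eq0 -nrm_eq0 eq_le nrm_ge0 andbT.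
have ar : nrm (a - a) < r by rewrite subrr nrm0 (le_lt_trans (nrm_ge0 _) zr).
have := @lipschitz_ineq R f (derive1 f) z a 0; rewrite mul0r; apply => t ht.
  by apply: (hol_cderiv Hf); exact: segment_in_ball ht zr ar.
by rewrite f0 ?nrm0//; exact: segment_in_ball ht zr ar.
Qed.

Lemma nonzero_near f a l : cderiv f a l -> f a != 0 ->
  exists2 r : R, 0 < r & forall z, cdisc a r z -> f z != 0.
Proof.
move=> fl fa; have n0 : 0 < nrm (f a) / 2 by rewrite divr_gt0// nrm_gt0.
have [d d0 H] := cderiv_cont fl n0; exists d => // z /H.
apply: contraTneq => ->; rewrite sub0r nrmN -ltNge.
by rewrite ltr_pdivrMr// ltr_pMr ?nrm_gt0// ltr1n.
Qed.

(** Induction on the number of functions. Near a point where the Wronskian of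
  all functions but the last is nonzero, the cofactors of the last row, divided
  by the last one, are coefficients [c j] of a relation between the columns,
  with last coefficient 1. Differentiating the relations among the first [N]
  rows gives a relation between the first [N] columns with coefficients
  [derive1 (c j)], which therefore vanish: the [c j] are constant, and the
  corresponding linear combination of the functions is zero on a disc, hence
  everywhere. *)
Lemma wronskian_neq0 N (f : 'I_N -> C -> C) :
  (forall j, holomorphic_on setT (f j)) ->
  (forall c : 'I_N -> C, (forall z, \sum_(j < N) c j * f j z = 0) -> forall j, c j = 0) ->
  ~ (forall z, \det (wronskian_mx f z) = 0).
Proof.
elim: N f => [|N IH] f Hf indep W0.
  by have := W0 0; rewrite det_mx00 => /eqP; rewrite oner_eq0.
pose g j := f (lift ord_max j).
have Hn k j : holomorphic_on setT (derive1n k (f j)).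
  exact: hol_derive1n openT (Hf j).
have gW : ~ forall z, \det (wronskian_mx g z) = 0.
  apply: IH => [j|c cg j]; first exact: Hf.
  pose c' i := if unlift ord_max i is Some j then c j else 0.
  have := indep c' _ (lift ord_max j); rewrite /c' liftK; apply => z.
  rewrite (bigD1_ord ord_max)//= unlift_none mul0r add0r -[RHS](cg z).
  by apply: eq_bigr => i _; rewrite liftK.
have [a ga] : exists a, \det (wronskian_mx g a) != 0.
  by have /existsNP[a /eqP] := gW; exists a.
have Hgd : holomorphic_on setT (fun z => \det (wronskian_mx g z)).
  apply: hol_det => i j; apply: (hol_eq_on openT _ (Hn i (lift ord_max j))).
  by move=> z _; rewrite mxE.
have [r r0 gr] : exists2 r : R, 0 < r &
    forall z, cdisc a r z -> \det (wronskian_mx g z) != 0.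
  by have [l Hl] := Hgd a I; exact: nonzero_near Hl ga.
have [c [Hc crel cmax]] : exists c : 'I_N.+1 -> C -> C,
    [/\ forall j, holomorphic_on (cdisc a r) (c j),
        forall (i : 'I_N.+1) z, \sum_j derive1n i (f j) z * c j z = 0 &
        forall z, cdisc a r z -> c ord_max z = 1].
  pose co j z := cofactor (wronskian_mx f z) ord_max j.
  have comax z : co ord_max z = \det (wronskian_mx g z).
    rewrite /co /cofactor -signr_odd oddD addbb expr0 mul1r; congr (\det _).
    by apply/matrixP => i j; rewrite !mxE lift_max.
  have Hco j : holomorphic_on setT (co j).
    apply: holM; first exact: hol_cst.
    apply: hol_det => i k.
    apply: (hol_eq_on openT _ (Hn (lift ord_max i) (lift j k))).
    by move=> z _; rewrite !mxE.
  have rel i z : \sum_j derive1n (i : 'I_N.+1) (f j) z * co j z = 0.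
    have /matrixP/(_ i ord_max) := mul_mx_adj (wronskian_mx f z).
    rewrite W0 !mxE mul0rn => E; rewrite -[RHS]E.
    by apply: eq_bigr => j _; rewrite !mxE.
  exists (fun j z => co j z / co ord_max z); split.
  - move=> j; apply: holM; first exact: sub_hol (Hco j).
    apply: holV; last exact: sub_hol (Hco ord_max).
    by move=> z /gr; rewrite comax.
  - move=> i z; under eq_bigr do rewrite mulrA.
    by rewrite -mulr_suml rel mul0r.
  - by move=> z /gr h; rewrite comax divff.
have dcmax z : cdisc a r z -> derive1 (c ord_max) z = 0.
  move=> zr; apply: cderiv_derive1.
  have [d d0 dr] := open_disc_in (@open_cdisc R a r) zr.
  by apply: cderiv_near d0 _ (cderiv_cst 1 z) => w /dr/cmax.
have oD := @open_cdisc R a r.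
have dc0 z j : cdisc a r z -> derive1 (c j) z = 0.
  move=> zr.
  have drel (i : 'I_N) : \sum_j derive1n i (f j) z * derive1 (c j) z = 0.
    have lt : (i < N.+1)%N by rewrite ltnS ltnW.
    have := @cderiv_sum_zero (cdisc a r) _ (index_enum 'I_N.+1)
      (fun j w => derive1n i (f j) w * c j w) z oD zr.
    have Hfc k : holomorphic_on (cdisc a r) (fun w => derive1n i (f k) w * c k w).
      by apply: holM => //; exact: sub_hol (Hn i k).
    move=> /(_ Hfc) -/(_ (fun w _ => crel (Ordinal lt) w)).
    have Di k : derive1 (fun w => derive1n i (f k) w * c k w) z =
        derive1n i.+1 (f k) z * c k z + derive1n i (f k) z * derive1 (c k) z.
      apply: cderiv_derive1; rewrite derive1nS.
      by apply: cderivM; [exact: hol_cderiv (Hn i k) I|exact: hol_cderiv (Hc k) zr].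
    under eq_bigr do rewrite Di.
    have lt' : (i.+1 < N.+1)%N by rewrite ltnS.
    by rewrite big_split/= (crel (Ordinal lt') z) add0r.
  have [->|[k ->]] : j = ord_max \/ exists k, j = lift ord_max k.
  - by case: (unliftP ord_max j) => [k ->|->]; [right; exists k|left].
  - exact: dcmax.
  pose v : 'cV[C]_N := \col_k derive1 (c (lift ord_max k)) z.
  have gv : wronskian_mx g z *m v = 0.
    apply/matrixP => i k'; rewrite !mxE -[RHS](drel i).
    rewrite [RHS](bigD1_ord ord_max)//= dcmax// mulr0 add0r.
    by apply: eq_bigr => k2 _; rewrite !mxE.
  have : v = 0.
    have gu : wronskian_mx g z \in unitmx by rewrite unitmxE unitfE gr.
    by rewrite -(mulKmx gu v) gv mulmx0.
  by move=> /matrixP/(_ k 0); rewrite !mxE.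
pose F z := \sum_j c j a * f j z.
have HF : holomorphic_on setT F.
  by apply: hol_sum => j _; apply: holM; [exact: hol_cst|exact: Hf].
have F0 z : cdisc a r z -> F z = 0.
  move=> zr; have lt : (0 < N.+1)%N by [].
  rewrite -[RHS](crel (Ordinal lt) z); apply: eq_bigr => j _.
  have -> : c j z = c j a by apply: (constant_on_disc (Hc j)) zr => w; exact: dc0.
  by rewrite mulrC.
have ar : cdisc a r a by rewrite /cdisc/= subrr nrm0.
have [Fz|/(_ a)/dnearC[d d0 Hd]] := entire_dichotomy HF.
  have := indep (c^~ a) Fz ord_max; rewrite cmax// => /eqP.
  by rewrite oner_eq0.
pose m := Num.min d r / 2.
have m0 : 0 < m by rewrite divr_gt0// lt_min d0.
have [m1 m2] : m < d /\ m < r by rewrite /m; have [] := leP d r; lra.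
have e : a + m%:C%C - a = m%:C%C by ring.
have a' : a + m%:C%C != a by rewrite -subr_eq0 e -nrm_gt0 nrmR normr_gt0 lt0r_neq0.
have := Hd (a + m%:C%C) a'; rewrite e nrmR gtr0_norm// => /(_ m1).
by rewrite F0 ?eqxx// /cdisc/= e nrmR gtr0_norm.
Qed.

End Wronskian.

(** * The Jacobi-Trudi determinant of the rows *)

Section JacobiTrudi.
Variable R : realType.
Local Notation C := (R[i] : numFieldType).
Implicit Types (l : intpart) (u z w : C) (U : set C) (h : int -> C -> C).

(** The function [((S - d/du) ^ j h) a], where [S] shifts the index of [h]; the
  two operators commute, and [jt_opS] is the resulting recursion. These are the
  entries of the Jacobi-Trudi matrices. *)
Definition jt_op h (j : nat) (a : int) (u : C) : C :=
  \sum_(k < j.+1) (-1) ^+ k * 'C(j, k)%:R * derive1n k (h (a + j%:Z - k%:Z)) u.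

Lemma jt_matrixE m h l u (i j : 'I_m) :
  jt_matrix m h l u i j = jt_op h j ((part l i)%:Z - i%:Z) u.
Proof. by rewrite mxE. Qed.

(** Pascal's rule. *)
Lemma binomial_shift j (X : nat -> C) :
  \sum_(k < j.+2) (-1) ^+ k * 'C(j.+1, k)%:R * X k =
  \sum_(k < j.+1) (-1) ^+ k * 'C(j, k)%:R * X k -
  \sum_(k < j.+1) (-1) ^+ k * 'C(j, k)%:R * X k.+1.
Proof.
rewrite big_ord_recl.
under eq_bigr => k _ do rewrite lift0 binS natrD mulrDr mulrDl.
rewrite big_split addrA; congr (_ + _); last first.
  by rewrite -sumrN; apply: eq_bigr => k _; rewrite exprS; ring.
rewrite [RHS]big_ord_recl big_ord_recr/= [X in _ + (_ + X)](_ : _ = 0) ?addr0.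
  by rewrite !bin0.
by rewrite bin_small// mulr0 mul0r.
Qed.

Lemma derive1n0_fun k u : derive1n k (fun=> 0 : C) u = 0.
Proof.
elim: k u => [//|k IH] u; rewrite derive1nS.
by apply: cderiv_derive1; apply: (cderiv_near ltr01 _ (cderiv_cst 0 u)) => w _; rewrite IH.
Qed.

Section Operator.
Variables (U : set C) (h : int -> C -> C).
Hypotheses (oU : open U) (Hh : forall a, holomorphic_on U (h a)).

Lemma hol_jt_op j a : holomorphic_on U (jt_op h j a).
Proof.
apply: hol_sum => k _; apply: holM; first exact: hol_cst.
exact: hol_derive1n.
Qed.

Lemma jt_op0 a u : jt_op h 0 a u = h a u.
Proof. by rewrite /jt_op big_ord1 !mul1r addr0 subr0. Qed.

Lemma jt_opS j a u : U u ->
  jt_op h j.+1 a u = jt_op h j (a + 1) u - derive1 (jt_op h j a) u.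
Proof.
move=> Uu.
pose X k := derive1n k (h (a + j.+1%:Z - k%:Z)) u.
have e1 (k : nat) : a + 1 + j%:Z - k%:Z = a + j.+1%:Z - k%:Z by lia.
have e2 (k : nat) : a + j.+1%:Z - k.+1%:Z = a + j%:Z - k%:Z by lia.
have -> : jt_op h j (a + 1) u = \sum_(k < j.+1) (-1) ^+ k * 'C(j, k)%:R * X k.
  by apply: eq_bigr => k _; rewrite e1.
have -> : derive1 (jt_op h j a) u = \sum_(k < j.+1) (-1) ^+ k * 'C(j, k)%:R * X k.+1.
  apply: cderiv_derive1; apply: cderiv_sum => k _; rewrite /X e2; apply: cderivZ.
  by apply: hol_cderiv Uu; exact: hol_derive1n.
exact: binomial_shift.
Qed.

Hypothesis h_neg : forall n, h (Negz n) = (fun=> 0).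

Lemma jt_op_lt0 j a u : a + j%:Z < 0 -> jt_op h j a u = 0.
Proof.
move=> aj; apply: big1 => k _.
have : a + j%:Z - k%:Z < 0 by lia.
by case: (_ - _) => // n _; rewrite h_neg derive1n0_fun mulr0.
Qed.

Lemma jt_op_eq0 j a u : a + j%:Z = 0 -> jt_op h j a u = h 0 u.
Proof.
move=> aj; rewrite /jt_op big_ord_recl big1 ?addr0; last first.
  move=> k _; rewrite aj lift0 sub0r.
  by rewrite (_ : - k.+1%:Z = Negz k)// h_neg derive1n0_fun mulr0.
by rewrite aj bin0 !mul1r.
Qed.

(** The new last row is zero except for its last entry, because [h] vanishes at
  negative indices. *)
Lemma det_jt_matrixS l m u : (size l <= m)%N ->
  \det (jt_matrix m.+1 h l u) = h 0 u * \det (jt_matrix m h l u).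
Proof.
move=> lm; rewrite (expand_det_row _ ord_max) (bigD1 ord_max)//= big1 ?addr0; last first.
  move=> j jm; rewrite jt_matrixE jt_op_lt0 ?mul0r//= /part nth_default//.
  have : (j < m)%N by rewrite ltn_neqAle -ltnS ltn_ord andbT.
  lia.
rewrite jt_matrixE jt_op_eq0; last by rewrite /= /part nth_default//; lia.
congr (_ * _); rewrite /cofactor -signr_odd oddD addbb expr0 mul1r.
by congr (\det _); apply/matrixP => i j; rewrite !mxE !lift_max.
Qed.

Lemma det_jt_matrix_add l t u :
  \det (jt_matrix (size l + t) h l u) = h 0 u ^+ t * \det (jt_matrix (size l) h l u).
Proof.
elim: t => [|t IH]; first by rewrite addn0 mul1r.
by rewrite addnS det_jt_matrixS ?leq_addr// IH exprS mulrA.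
Qed.

Lemma det_jt_matrix0 m u : \det (jt_matrix m h part0 u) = h 0 u ^+ m.
Proof. by have := det_jt_matrix_add part0 m u; rewrite /= det_mx00 mulr1. Qed.

End Operator.

Section Rows.
Variables (N : nat) (U : set C) (f : 'I_N -> C -> C) (phi : C -> C).
Hypotheses (oU : open U) (Hf : forall j, holomorphic_on U (f j)).
Hypothesis Hphi : holomorphic_on U phi.

Definition scaled_plucker l u := phi u * plucker f l u.
Local Notation D := scaled_plucker.

Lemma hol_plucker l : holomorphic_on U (plucker f l).
Proof.
rewrite /plucker; case: (size l <= N)%N; last exact: hol_cst.
apply: hol_det => i j.
apply: (hol_eq_on oU _ (hol_derive1n (part l (N - i.+1) + i)%N oU (Hf j))).
by move=> z _; rewrite mxE.
Qed.

Lemma hol_scaled_plucker l : holomorphic_on U (D l).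
Proof. by apply: holM => //; exact: hol_plucker. Qed.

Lemma hol_at_row a : holomorphic_on U (at_row D a).
Proof. by case: a => n; [exact: hol_scaled_plucker|exact: hol_cst]. Qed.

Lemma hol_at_col a : holomorphic_on U (at_col D a).
Proof. by case: a => n; [exact: hol_scaled_plucker|exact: hol_cst]. Qed.

Lemma plucker0 u : plucker f part0 u = \det (wronskian_mx f u).
Proof.
rewrite /plucker /=; congr (\det _); apply/matrixP => i j.
by rewrite !mxE /part nth_nil.
Qed.

Lemma nth_part_row n k : part (part_row n) k = if k == 0%N then n else 0%N.
Proof. by case: n k => [|n] [|k]; rewrite /part/= ?nth_nil. Qed.

End Rows.

(** The coordinate of a one-row partition is a determinant whose last row alone
  depends on the partition; [g] consists of the scaled cofactors of that row.
  Indices below the range of partitions give a repeated row. *)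
Lemma row_cofactors N (f : 'I_N -> C -> C) (phi : C -> C) U :
  open U -> (forall j, holomorphic_on U (f j)) -> holomorphic_on U phi ->
  exists2 g : 'I_N -> C -> C, forall j, holomorphic_on U (g j) &
    forall (p : nat) u, at_row (scaled_plucker f phi) (p%:Z + 1 - N%:Z) u =
      \sum_j derive1n p (f j) u * g j u.
Proof.
case: N f => [|N] f oU Hf Hphi.
  exists f => // p u; rewrite big_ord0 (_ : p%:Z + 1 - 0 = p.+1%:Z); last by lia.
  by rewrite /at_row /scaled_plucker /plucker/= mulr0.
exists (fun j u => phi u * cofactor (wronskian_mx f u) ord_max j) => [j|p u].
  apply: holM => //; apply: holM; first exact: hol_cst.
  apply: hol_det => i k.
  apply: (hol_eq_on oU _ (hol_derive1n (lift ord_max i) oU (Hf (lift j k)))).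
  by move=> z _; rewrite !mxE.
pose A : 'M[C]_N.+1 :=
  \matrix_(i, j) derive1n (if i == ord_max then p else i) (f j) u.
have -> : \sum_j derive1n p (f j) u * (phi u * cofactor (wronskian_mx f u) ord_max j)
    = phi u * \det A.
  rewrite (expand_det_row _ ord_max) mulr_sumr; apply: eq_bigr => j _.
  rewrite mulrCA; congr (_ * (_ * _)); first by rewrite mxE eqxx.
  rewrite /cofactor; congr (_ * \det _); apply/matrixP => i k; rewrite !mxE.
  by rewrite eq_sym (negPf (neq_lift _ _)).
have [pN|Np] := ltnP p N.
  have -> : \det A = 0.
    apply: (determinant_alternate (i1 := Ordinal (ltnW pN : p < N.+1)%N) (i2 := ord_max)).
      by apply/eqP => /(congr1 val)/= e; rewrite e ltnn in pN.
    move=> j; rewrite !mxE eqxx; case: eqP => // /(congr1 val)/=.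
  have : p%:Z + 1 - N.+1%:Z < 0 by lia.
  by rewrite mulr0; case: (_ - _).
rewrite (_ : p%:Z + 1 - N.+1%:Z = (p - N)%:Z); last by lia.
rewrite /at_row /scaled_plucker /plucker; congr (_ * _).
rewrite ifT; last by case: (p - N)%N.
congr (\det _); apply/matrixP => i j; rewrite !mxE nth_part_row.
congr (derive1n _ _ _); rewrite subSS subn_eq0.
case: eqVneq => [->|im]; first by rewrite leqnn/= subnK.
have : (i < N)%N by rewrite ltn_neqAle -ltnS ltn_ord andbT.
by rewrite ltnNge => /negPf->.
Qed.

(** The shift of [h] differentiates the rows of derivatives of [f], so that
  [S - d/du] only differentiates [g], with a minus sign. *)
Lemma jt_op_row N (f g : 'I_N -> C -> C) h U : open U ->
  (forall a, holomorphic_on U (h a)) ->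
  (forall j, holomorphic_on U (f j)) -> (forall j, holomorphic_on U (g j)) ->
  (forall (p : nat) u, h (p%:Z + 1 - N%:Z) u = \sum_j derive1n p (f j) u * g j u) ->
  forall j (p : nat) u, U u -> jt_op h j (p%:Z + 1 - N%:Z) u =
    \sum_l derive1n p (f l) u * ((-1) ^+ j * derive1n j (g l) u).
Proof.
move=> oU Hh Hf Hg hE; elim=> [|j IH] p u Uu.
  by rewrite jt_op0 hE; apply: eq_bigr => l _; rewrite mul1r.
rewrite (jt_opS oU)//.
have -> : derive1 (jt_op h j (p%:Z + 1 - N%:Z)) u = \sum_l
    (derive1n p.+1 (f l) u * ((-1) ^+ j * derive1n j (g l) u) +
     derive1n p (f l) u * ((-1) ^+ j * derive1n j.+1 (g l) u)).
  have [d d0 dU] := open_disc_in oU Uu.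
  apply: cderiv_derive1.
  apply: (cderiv_near (f := fun u => \sum_l
     derive1n p (f l) u * ((-1) ^+ j * derive1n j (g l) u)) d0).
    by move=> w /dU Uw; rewrite IH.
  apply: cderiv_sum => l _; apply: cderivM.
    by apply: hol_cderiv Uu; exact: hol_derive1n.
  apply: cderivZ.
  by apply: hol_cderiv Uu; exact: hol_derive1n.
rewrite (_ : p%:Z + 1 - N%:Z + 1 = p.+1%:Z + 1 - N%:Z); last by lia.
rewrite IH// big_split/= opprD addrA subrr add0r -sumrN.
by apply: eq_bigr => l _; rewrite exprS; ring.
Qed.

(** A dependency between the [n.+1] vectors [A i] of length [n] is a dependency
  between the rows of [E]. *)
Lemma det_low_rank_rows (F : fieldType) n m (E : 'M[F]_m) (A : nat -> 'I_n -> F)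
    (B : 'I_n -> 'I_m -> F) :
  (n < m)%N ->
  (forall i j : 'I_m, (i <= n)%N -> E i j = \sum_l A i l * B l j) ->
  \det E = 0.
Proof.
move=> nm EAB.
pose A' : 'M[F]_(n.+1, n) := \matrix_(i, l) A i l.
have ker0 : kermx A' != 0.
  by rewrite -mxrank_eq0 mxrank_ker -lt0n subn_gt0 ltnS rank_leq_col.
have [x xA x0] : exists2 x : 'rV[F]_n.+1, x *m A' = 0 & x != 0.
  by have /rowV0Pn[x xk x0] := ker0; exists x => //; exact/sub_kermxP.
apply/eqP/det0P; exists (\row_(i < m) if (i <= n)%N then x 0 (inord i) else 0).
  have [i xi] : exists i, x 0 i != 0.
    apply: contrapT => no; case/eqP: x0; apply/rowP => i; rewrite !mxE; apply/eqP.
    by apply: contrapT => xi; apply: no; exists i; apply/negP.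
  apply: contra_neq xi => /rowP.
  have im : (i < m)%N by rewrite (leq_trans (ltn_ord i)).
  by move=> /(_ (Ordinal im)); rewrite !mxE/= -ltnS ltn_ord inord_val.
apply/rowP => j; rewrite !mxE.
transitivity (\sum_(i < m | (i < n.+1)%N) x 0 (inord i) * \sum_l A i l * B l j).
  rewrite [RHS]big_mkcond; apply: eq_bigr => i _; rewrite mxE ltnS.
  by case: ifP => [le|_]; rewrite ?mul0r// EAB.
rewrite -(big_ord_widen m (fun i => x 0 (inord i) * \sum_l A i l * B l j))//.
under eq_bigr do rewrite mulr_sumr inord_val.
rewrite exchange_big big1//= => l _.
have /rowP/(_ l) := xA; rewrite !mxE => E0.
transitivity ((\sum_i x 0 i * A' i l) * B l j); last by rewrite E0 mul0r.
by rewrite mulr_suml; apply: eq_bigr => i _; rewrite mxE mulrA.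
Qed.

Lemma intpart_inj : injective parts.
Proof.
by move=> [s hs] [s' hs'] /= e; case: s' / e hs' => hs'; rewrite (bool_irrelevance hs hs').
Qed.

Lemma part_row0 : part_row 0 = part0. Proof. exact: intpart_inj. Qed.

Lemma part_col0 : part_col 0 = part0. Proof. exact: intpart_inj. Qed.

Lemma part_pos (l : intpart) i : (i < size l)%N -> (0 < part l i)%N.
Proof.
move=> il; rewrite lt0n; apply/negP => /eqP h.
have /andP[_] := partsP l; by rewrite -[in X in X \notin _]h /part mem_nth.
Qed.

(** For [m = N] the rows of the matrix are those of the Pluecker determinant,
  in reverse order, times a matrix that does not depend on [l] ([jt_op_row]).
  The determinant of the latter is read off from the empty partition, whose
  Jacobi-Trudi matrix is triangular. When [l] has more than [N] parts, the
  first [N.+1] rows factor through a space of dimension [N]. The factor [h 0]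
  per additional row moves between different [m]. *)
Lemma jacobi_trudi N (f : 'I_N -> C -> C) (phi : C -> C) U l m u :
  open U -> (forall j, holomorphic_on U (f j)) -> holomorphic_on U phi ->
  U u -> scaled_plucker f phi part0 u != 0 -> (size l <= m)%N ->
  \det (jt_matrix m (at_row (scaled_plucker f phi)) l u) *
    scaled_plucker f phi part0 u =
  scaled_plucker f phi l u * scaled_plucker f phi part0 u ^+ m.
Proof.
move=> oU Hf Hphi Uu D0 lm.
set D := scaled_plucker f phi; set h := at_row D.
have Hh : forall a, holomorphic_on U (h a) := hol_at_row oU Hf Hphi.
have h_neg n : h (Negz n) = (fun=> 0) by [].
have h0 : h 0 u = D part0 u.
  by rewrite /h /= part_row0.
have [g Hg hE] := row_cofactors oU Hf Hphi.
pose G k j := (-1) ^+ j * derive1n j (g k) u.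
have entry (p j : nat) : jt_op h j (p%:Z + 1 - N%:Z) u =
    \sum_k derive1n p (f k) u * G k j by exact: (jt_op_row oU Hh Hf Hg hE).
suff [m0 lm0 Hm0] : exists2 m0, (size l <= m0)%N &
    \det (jt_matrix m0 h l u) * D part0 u = D l u * D part0 u ^+ m0.
  have add t := det_jt_matrix_add h_neg l t u.
  move: Hm0; rewrite -(subnKC lm) -(subnKC lm0) !add h0 => E.
  have {}E : \det (jt_matrix (size l) h l u) * D part0 u = D l u * D part0 u ^+ size l.
    apply: (mulfI (expf_neq0 (m0 - size l) D0)).
    by rewrite mulrA E mulrCA -exprD addnC.
  by rewrite -mulrA E mulrCA -exprD addnC.
have [lN|Nl] := leqP (size l) N; last first.
  exists (size l) => //.
  have -> : D l u = 0 by rewrite /D /scaled_plucker /plucker leqNgt Nl mulr0.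
  rewrite (det_low_rank_rows (n := N) (B := fun k j => G k j)
    (A := fun i k => derive1n (part l i + N - i.+1)%N (f k) u)) ?mul0r// => i j iN.
  rewrite jt_matrixE -entry; congr jt_op.
  by have := part_pos (leq_ltn_trans iN Nl); lia.
exists N => //.
(* Pluecker determinants list the parts in increasing order. *)
pose rev := perm (@rev_ord_inj N).
pose GM : 'M[C]_N := \matrix_(k, j) G k j.
pose P l' : 'M[C]_N := \matrix_(i, j) derive1n (part l' (N - i.+1) + i) (f j) u.
have fact l' : (size l' <= N)%N ->
    \det (jt_matrix N h l' u) = plucker f l' u * (\det (perm_mx rev : 'M[C]_N) * \det GM).
  move=> l'N; rewrite /plucker l'N -/(P l').
  rewrite mulrCA mulrA -!det_mulmx -row_permE; congr (\det _).
  apply/matrixP => i j; rewrite jt_matrixE !mxE.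
  rewrite (_ : (part l' i)%:Z - i%:Z = (part l' i + (N - i.+1))%N%:Z + 1 - N%:Z); last first.
    by have := ltn_ord i; lia.
  rewrite entry; apply: eq_bigr => k _; rewrite !mxE permE /=.
  by rewrite (_ : (N - (N - i.+1).+1 = i)%N)//; have := ltn_ord i; lia.
rewrite fact//; have := fact part0 isT; rewrite det_jt_matrix0// h0.
set X := _ * \det GM => E.
rewrite /D /scaled_plucker in E *.
by rewrite E; ring.
Qed.

End JacobiTrudi.

(** * Rows of a partition, columns of its conjugate, and their shuffle *)

Section Shuffle.
Local Open Scope nat_scope.
Implicit Types (l : intpart).

Lemma part_mono l i j : i <= j -> part l j <= part l i.
Proof.
move=> ij; have [jl|lj] := ltnP j (size l); last by rewrite /part nth_default.
have /andP[hs _] := partsP l.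
have tr : transitive geq by move=> a b c /= ba cb; exact: leq_trans cb ba.
have rf : reflexive geq by move=> a /=.
by apply: (sorted_leq_nth tr rf 0 hs); rewrite ?inE// (leq_ltn_trans ij).
Qed.

(** The entries above [c] form an initial segment of a nonincreasing
  sequence. *)
Lemma lt_count_sorted (s : seq nat) (k c : nat) : sorted geq s ->
  (k < count (fun p => c < p) s) = (c < nth 0 s k).
Proof.
elim: s k => [|x s IH] k /= hs; first by rewrite nth_nil.
have hs' := path_sorted hs.
have [cx|xc] := ltnP c x; first by case: k => [|k] //=; rewrite add1n ltnS IH.
have all_le : all (geq x) s.
  by apply: order_path_min hs => a b d /= ba cb; exact: leq_trans cb ba.
have c0 : count (fun p => c < p) s = 0.
  apply/eqP; rewrite -leqn0 leqNgt -has_count; apply/hasPn => y ys.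
  by rewrite -leqNgt (leq_trans _ xc)//; exact: (allP all_le).
rewrite c0 addn0 ltn0; apply/esym/negbTE; rewrite -leqNgt.
case: k => [|k] //=; have [ks|sk] := ltnP k (size s); last by rewrite nth_default.
by rewrite (leq_trans _ xc)//; apply: (allP all_le); exact: mem_nth.
Qed.

Lemma lt_part_conj l k c : (k < part (part_conj l) c) = (c < part l k).
Proof.
have /andP[hs _] := partsP l.
rewrite {1}/part/=; have [cl|lc] := ltnP c (part l 0).
  by rewrite nth_mkseq// lt_count_sorted.
rewrite nth_default ?size_mkseq// ltn0; apply/esym/negbTE.
by rewrite -leqNgt (leq_trans _ lc)// part_mono.
Qed.

Lemma part_conj_le l n c : size l <= n -> part (part_conj l) c <= n.
Proof.
move=> ln; rewrite leqNgt lt_part_conj /part.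
by rewrite nth_default// (leq_trans ln).
Qed.

Section Perm.
Variables (l : intpart) (N m : nat).
Hypotheses (lN : size l <= N) (lm : part l 0 <= m).

(** The rows of the matrix of derivatives that enter the Pluecker determinant
  of [l]. The [col_pos] are the remaining rows among the first [N + m]. *)
Definition row_pos (i : 'I_N) : nat := part l (N - i.+1) + i.
Definition col_pos (c : 'I_m) : nat := N + c - part (part_conj l) c.

Lemma row_pos_lt i : row_pos i < N + m.
Proof.
rewrite /row_pos addnC -addSn leq_add//.
by rewrite (leq_trans _ lm)// part_mono.
Qed.

Lemma col_pos_lt c : col_pos c < N + m.
Proof. by rewrite /col_pos (leq_ltn_trans (leq_subr _ _))// ltn_add2l. Qed.

Lemma row_pos_mono (i j : 'I_N) : i < j -> row_pos i < row_pos j.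
Proof.
move=> ij; rewrite /row_pos -addnS leq_add// part_mono//.
by rewrite leq_sub2l// ltnS ltnW.
Qed.

Lemma col_pos_mono (c d : 'I_m) : c < d -> col_pos c < col_pos d.
Proof.
move=> cd; rewrite /col_pos.
have h1 := part_conj_le c lN; have h2 := part_conj_le d lN.
have h3 : part (part_conj l) d <= part (part_conj l) c by rewrite part_mono// ltnW.
lia.
Qed.

Lemma col_pos_eq (c d : 'I_m) : (col_pos c == col_pos d) = (c == d).
Proof.
rewrite -val_eqE /=.
case: (ltngtP c d) => [/col_pos_mono h|/col_pos_mono h|/val_inj->].
- by rewrite ltn_eqF.
- by rewrite gtn_eqF.
- by rewrite eqxx.
Qed.

(** With [k := N - i.+1], the difference [row_pos i - col_pos c] is the hook
  length of the box in row [k] and column [c] if this box belongs to [l], and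
  negative otherwise. *)
Lemma col_lt_row (i : 'I_N) (c : 'I_m) :
  (col_pos c < row_pos i) = (N - i.+1 < part (part_conj l) c).
Proof.
rewrite /col_pos /row_pos; have h1 := part_conj_le c lN.
have := lt_part_conj l (N - i.+1) c; have := ltn_ord i.
have [h|h] := ltnP (N - i.+1) (part (part_conj l) c) => iN /esym; last first.
  by move=> /negbT; rewrite -leqNgt => h2; apply/negbTE; rewrite -leqNgt; lia.
by move=> h2; lia.
Qed.

Lemma row_neq_col (i : 'I_N) (c : 'I_m) : row_pos i != col_pos c.
Proof.
rewrite /col_pos /row_pos; have h1 := part_conj_le c lN.
have := lt_part_conj l (N - i.+1) c; have := ltn_ord i.
have [h|h] := ltnP (N - i.+1) (part (part_conj l) c) => iN /esym; last first.
  by move=> /negbT; rewrite -leqNgt => h2; lia.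
by move=> h2; lia.
Qed.

Definition shuffle_fun (x : 'I_(N + m)) : 'I_(N + m) :=
  match fintype.split x with
  | inl i => Ordinal (row_pos_lt i)
  | inr c => Ordinal (col_pos_lt c)
  end.

Lemma shuffle_inj : injective shuffle_fun.
Proof.
have rI i j : row_pos i = row_pos j -> i = j.
  move=> e; apply: val_inj => /=.
  by have [/row_pos_mono|/row_pos_mono|//] := ltngtP i j; rewrite e ltnn.
have cI c d : col_pos c = col_pos d -> c = d.
  move=> e; apply: val_inj => /=.
  by have [/col_pos_mono|/col_pos_mono|//] := ltngtP c d; rewrite e ltnn.
move=> x y; rewrite /shuffle_fun.
case: (fintype.splitP x) => [i xi|c xc]; case: (fintype.splitP y) => [j yj|d yd] /(congr1 val)/=.
- by move=> /rI e; apply: val_inj; rewrite /= xi yj e.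
- by move=> /eqP; rewrite (negPf (row_neq_col _ _)).
- by move=> /eqP; rewrite eq_sym (negPf (row_neq_col _ _)).
- by move=> /cI e; apply: val_inj; rewrite /= xc yd e.
Qed.

Definition shuffle : {perm 'I_(N + m)} := perm shuffle_inj.

Lemma shuffle_lshift i : shuffle (lshift m i) = row_pos i :> nat.
Proof.
rewrite permE /shuffle_fun; case: fintype.splitP => [j /= /val_inj->//|c /= e].
by have := ltn_ord i; rewrite e ltnNge leq_addr.
Qed.

Lemma shuffle_rshift c : shuffle (rshift N c) = col_pos c :> nat.
Proof.
rewrite permE /shuffle_fun; case: fintype.splitP => [j /= e|d /= /addnI/val_inj->//].
by have := ltn_ord j; rewrite -e ltnNge leq_addr.
Qed.

Local Open Scope ring_scope.

Lemma sgz_sub (a b : nat) : sgz (b%:Z - a%:Z) =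
  if (a < b)%N then 1 else if (b < a)%N then -1 else 0.
Proof.
by case: (ltngtP a b) => h; [rewrite gtr0_sgz|rewrite ltr0_sgz|rewrite h subrr sgz0]; 
  rewrite ?subr_gt0 ?subr_lt0 ?ltz_nat.
Qed.

(** Permuting the nodes [0, ..., n - 1] of a Vandermonde determinant multiplies
  it by the sign of the permutation; compare the signs of the two product
  formulas. *)
Lemma sign_perm_vandermonde n (s : {perm 'I_n}) :
  (-1) ^+ s = \prod_(i < n) \prod_(j < n | (i < j)%N) sgz ((s j)%:Z - (s i)%:Z) :> int.
Proof.
pose a : 'rV[int]_n := \row_j (j : nat)%:Z.
have := det_Vandermonde (\row_j (s j : nat)%:Z : 'rV[int]_n).
have -> : Vandermonde n (\row_j (s j : nat)%:Z) = col_perm s (Vandermonde n a) :> 'M[int]_n.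
  by apply/matrixP => i j; rewrite !mxE.
rewrite col_permE det_mulmx det_perm det_Vandermonde => /(congr1 (@sgz int)).
have sgz_prod (I : Type) (r : seq I) (P : pred I) (F : I -> int) :
    sgz (\prod_(i <- r | P i) F i) = \prod_(i <- r | P i) sgz (F i).
  by elim/big_rec2: _ => [//|i x y _ <-]; rewrite sgzM.
rewrite sgzM sgz_prod [X in X * _]big1 ?mul1r; last first.
  move=> i _; rewrite sgz_prod big1// => j ij.
  by rewrite !mxE sgz_sub ij.
rewrite odd_permV sgzX => E.
transitivity (sgz (-1 : int) ^+ s); first by rewrite sgzN1.
rewrite E sgz_prod; apply: eq_bigr => i _; rewrite sgz_prod.
by apply: eq_bigr => j _; rewrite !mxE.
Qed.

(** The shuffle is increasing on the rows and on the columns, and by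
  [col_lt_row] its inversions correspond to the boxes of [l]. *)
Lemma sign_shuffle :
  (-1) ^+ shuffle = \prod_(c < m) (-1) ^+ part (part_conj l) c :> int.
Proof.
rewrite sign_perm_vandermonde big_split_ord/= [X in _ * X]big1 ?mulr1; last first.
  move=> c _; rewrite big_mkcond big_split_ord/= big1 ?mul1r.
    rewrite big1// => d _; case: ifP => //; rewrite ltn_add2l => cd.
    by rewrite !shuffle_rshift sgz_sub col_pos_mono.
  by move=> j _; rewrite ltnNge (leq_trans (ltnW (ltn_ord j)) (leq_addr _ _)).
transitivity (\prod_(i < N) \prod_(c < m)
   if (N - i.+1 < part (part_conj l) c)%N then -1 else 1 : int).
  apply: eq_bigr => i _; rewrite big_mkcond big_split_ord/= big1 ?mul1r.
    apply: eq_bigr => c _; rewrite (leq_trans (ltn_ord i) (leq_addr _ _)).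
    rewrite shuffle_lshift shuffle_rshift sgz_sub -col_lt_row.
    by have := row_neq_col i c; case: ltngtP.
  move=> j _; case: ifP => // ij.
  by rewrite !shuffle_lshift sgz_sub row_pos_mono.
rewrite exchange_big; apply: eq_bigr => c _ /=.
rewrite (reindex_inj rev_ord_inj)/=.
rewrite (eq_bigr (fun i : 'I_N => if (i < part (part_conj l) c)%N then -1 else 1 : int));
  last first.
  by move=> i _; have := ltn_ord i => iN; rewrite (_ : (N - (N - i.+1).+1)%N = i :> nat)//; lia.
rewrite -big_mkcond/= -(big_ord_widen N (fun=> -1 : int) (part_conj_le c lN)).
by rewrite prodr_const card_ord.
Qed.

End Perm.
End Shuffle.

(** * The dual Jacobi-Trudi determinant *)

Section Dual.
Variable R : realType.
Local Notation C := (R[i] : numFieldType).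
Implicit Types (l : intpart) (u z w : C) (U : set C).

Lemma nth_part_col n k : part (part_col n) k = (k < n)%N.
Proof. by rewrite /part/= nth_nseq; case: ifP. Qed.

Lemma at_col_gt N (f : 'I_N -> C -> C) phi (a : int) u :
  N%:Z < a -> at_col (scaled_plucker f phi) a u = 0.
Proof.
case: a => [n|n] //; rewrite ltz_nat => Nn.
by rewrite /= /scaled_plucker /plucker size_nseq leqNgt Nn mulr0.
Qed.

Lemma jt_op_col_gt N (f : 'I_N -> C -> C) phi j (a : int) u :
  N%:Z < a -> jt_op (at_col (scaled_plucker f phi)) j a u = 0.
Proof.
move=> Na; apply: big1 => k _.
have lt : N%:Z < a + j%:Z - k%:Z by have := ltn_ord k; lia.
rewrite (_ : at_col _ _ = (fun=> 0)) ?derive1n0_fun ?mulr0//.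
by apply/funext => w; exact: at_col_gt.
Qed.

(** Expansion of a determinant with two equal columns. *)
Lemma col_relation N (f : 'I_N -> C -> C) phi u (j : 'I_N) :
  \sum_(p < N.+1) (-1) ^+ p * at_col (scaled_plucker f phi) (N%:Z - p%:Z) u *
    derive1n p (f j) u = 0.
Proof.
pose B : 'M[C]_N.+1 := \matrix_(q, c)
  derive1n q (f (if unlift ord0 c is Some k then k else j)) u.
have B0 : \det B = 0.
  rewrite -det_tr; apply: (determinant_alternate (neq_lift ord0 j)) => q.
  by rewrite !mxE unlift_none liftK.
transitivity (phi u * \det B); last by rewrite B0 mulr0.
rewrite (expand_det_col _ ord0) mulr_sumr.
apply: eq_bigr => q _.
rewrite (_ : N%:Z - q%:Z = (N - q)%N); last by (have := ltn_ord q; lia).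
have -> : at_col (scaled_plucker f phi) (N - q)%N u = phi u * \det (row' q (col' ord0 B)).
  rewrite /= /scaled_plucker /plucker size_nseq leq_subr.
  congr (_ * \det _); apply/matrixP => i k; rewrite !mxE liftK nth_part_col.
  have e : ((N - i.+1 < N - q)%N + i)%N = lift q i :> nat.
    rewrite /= /bump; congr (nat_of_bool _ + _)%N.
    by have := ltn_ord i; have := ltn_ord q; lia.
  by rewrite e.
by rewrite mxE unlift_none /cofactor addn0; ring.
Qed.

(** The [r]-th derivative of [col_relation]: by [jt_opS] the coefficients of
  the derivatives of [f j] in it are, up to sign, entries of the dual
  Jacobi-Trudi matrix. *)
Lemma jt_op_col_relation N (f : 'I_N -> C -> C) phi U :
  open U -> (forall j, holomorphic_on U (f j)) -> holomorphic_on U phi ->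
  forall r M u (j : 'I_N), U u -> (N + r < M)%N ->
  \sum_(p < M) (-1) ^+ p * jt_op (at_col (scaled_plucker f phi)) r (N%:Z - p%:Z) u *
    derive1n p (f j) u = 0.
Proof.
move=> oU Hf Hphi; set h := at_col _.
have Hh : forall a, holomorphic_on U (h a) := hol_at_col oU Hf Hphi.
have h_neg n : h (Negz n) = (fun=> 0) by [].
elim=> [|r IH] M u j Uu NM.
  rewrite -[RHS](col_relation f phi u j).
  rewrite addn0 in NM.
  rewrite [RHS](big_ord_widen M (fun p => (-1) ^+ p * h (N%:Z - p%:Z) u *
    derive1n p (f j) u))// [RHS]big_mkcond.
  apply: eq_bigr => p _; rewrite jt_op0; case: ifP => // /negbT; rewrite -leqNgt => Np.
  by rewrite -(jt_op0 h) jt_op_lt0 ?mulr0 ?mul0r//; lia.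
case: M NM => [//|M] NM.
have NrM : (N + r < M)%N by lia.
under eq_bigr => p _ do rewrite (jt_opS oU Hh)// mulrBr mulrBl.
rewrite sumrB big_ord_recl jt_op_col_gt ?mulr0 ?mul0r ?add0r; last by rewrite /=; lia.
rewrite [X in _ - X]big_ord_recr/=.
have -> : derive1 (jt_op h r (N%:Z - M%:Z)) u = 0.
  apply: cderiv_derive1; apply: (cderiv_near ltr01 _ (cderiv_cst 0 u)) => w _.
  by rewrite jt_op_lt0//; lia.
rewrite mulr0 mul0r addr0.
have Hd (p : nat) : holomorphic_on U (fun w => (-1) ^+ p * jt_op h r (N%:Z - p%:Z) w *
    derive1n p (f j) w).
  apply: holM; last exact: hol_derive1n.
  by apply: holM; [exact: hol_cst|exact: hol_jt_op].
transitivity (- \sum_(p < M) derive1 (fun w => (-1) ^+ p *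
    jt_op h r (N%:Z - p%:Z) w * derive1n p (f j) w) u); last first.
  rewrite (cderiv_sum_zero (F := fun (p : 'I_M) w => (-1) ^+ p *
    jt_op h r (N%:Z - p%:Z) w * derive1n p (f j) w) oU Uu) ?oppr0// => w Uw.
  exact: IH.
rewrite -sumrB -sumrN; apply: eq_bigr => p _.
have -> : N%:Z - (bump 0 p)%:Z + 1 = N%:Z - p%:Z by rewrite /bump; lia.
have D1 := hol_cderiv (hol_jt_op oU Hh r (N%:Z - p%:Z)) Uu.
have D2 := hol_cderiv (hol_derive1n p oU (Hf j)) Uu.
have -> := cderiv_derive1 (cderivM (cderivZ ((-1) ^+ p) D1) D2).
rewrite /bump leq0n add1n add0n.
move: (jt_op _ _ _ _) (derive1 (jt_op _ _ _) _) (derive1 (derive1n _ _) _) => x y z.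
by rewrite exprS; ring.
Qed.

(** Complementary minors. The rows of derivatives [0, ..., N + m - 1] of [f]
  satisfy [m] relations, the rows of [Td], with a triangular block at the end.
  Multiplying [T], the relations completed by the first [N] unit vectors, by
  the derivatives of [f] and the unit vectors at the [col_pos] gives a block
  triangular matrix with the Wronskian and, up to signs of its columns, the
  transposed dual Jacobi-Trudi matrix on the diagonal. The two factors have as
  determinants, up to sign, a power of the scaled Wronskian and the Pluecker
  coordinate; all signs together cancel by [sign_shuffle]. If [l] has more than
  [N] parts the first row vanishes. *)
Lemma dual_jacobi_trudi N (f : 'I_N -> C -> C) (phi : C -> C) U l m u :
  open U -> (forall j, holomorphic_on U (f j)) -> holomorphic_on U phi ->
  U u -> scaled_plucker f phi part0 u != 0 -> (part l 0 <= m)%N ->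
  \det (jt_matrix m (at_col (scaled_plucker f phi)) (part_conj l) u) *
    scaled_plucker f phi part0 u =
  scaled_plucker f phi l u * scaled_plucker f phi part0 u ^+ m.
Proof.
move=> oU Hf Hphi Uu; set D := scaled_plucker f phi => D0 lm; set h := at_col D.
have Hh : forall a, holomorphic_on U (h a) := hol_at_col oU Hf Hphi.
have h_neg n : h (Negz n) = (fun=> 0) by [].
have h0 : h 0 u = D part0 u by rewrite /h /= part_col0.
have [lN|Nl] := leqP (size l) N; last first.
  have -> : D l u = 0 by rewrite /D /scaled_plucker /plucker leqNgt Nl mulr0.
  have m0 : (0 < m)%N.
    by apply: leq_trans lm; apply: part_pos; exact: leq_ltn_trans Nl.
  rewrite (expand_det_row _ (Ordinal m0)) big1 ?mul0r// => j _.
  rewrite jt_matrixE jt_op_col_gt ?mul0r//= subr0 ltz_nat lt_part_conj.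
  exact: part_pos.
pose rho r (p : nat) := (-1) ^+ p * jt_op h r (N%:Z - p%:Z) u.
pose Td : 'M[C]_(m, N + m) := \matrix_(r, p) rho r p.
pose T : 'M[C]_(N + m) := col_mx (row_mx 1%:M 0) Td.
pose Fm : 'M[C]_(N + m, N) := \matrix_(p, j) derive1n p (f j) u.
pose Em : 'M[C]_(N + m, m) := \matrix_(p, c) ((p : nat) == col_pos l N c)%:R.
pose J := jt_matrix m h (part_conj l) u.
pose S : C := \prod_(c < m) (-1) ^+ col_pos l N c.
have posE (c : 'I_m) : (N + c = col_pos l N c + part (part_conj l) c)%N.
  by rewrite /col_pos subnK// (leq_trans (part_conj_le c lN))// leq_addr.
have detT : \det T = \prod_(c < m) ((-1) ^+ (N + c) * D part0 u).
  rewrite /T -[Td]hsubmxK -/(block_mx _ _ _ _) det_lblock det1 mul1r.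
  rewrite det_trig; last first.
    apply/is_trig_mxP => i j ij; rewrite !mxE /= /rho jt_op_lt0 ?mulr0//; lia.
  apply: eq_bigr => i _; rewrite !mxE /= /rho jt_op_eq0 ?h0//; lia.
pose s := shuffle lN lm.
have detG : \det (row_mx Fm Em) = (-1) ^+ s * plucker f l u.
  have : \det (row_perm s (row_mx Fm Em)) = plucker f l u.
    rewrite /plucker lN.
    have -> : row_perm s (row_mx Fm Em) = block_mx
        (\matrix_(i, j) derive1n (part l (N - i.+1) + i) (f j) u) 0
        (\matrix_(c, j) derive1n (col_pos l N c) (f j) u) 1%:M.
      rewrite -[row_perm _ _]submxK; congr block_mx; apply/matrixP => i j.
      - by rewrite !mxE (unsplitK (inl j)) mxE shuffle_lshift.
      - rewrite !mxE (unsplitK (inr j)) mxE shuffle_lshift.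
        by rewrite (negPf (row_neq_col lN lm i j)).
      - by rewrite !mxE (unsplitK (inl j)) mxE shuffle_rshift.
      - by rewrite !mxE (unsplitK (inr j)) mxE shuffle_rshift (col_pos_eq lN lm).
    by rewrite det_lblock det1 mulr1.
  rewrite row_permE det_mulmx det_perm => <-.
  by rewrite mulrA -expr2 sqrr_sign mul1r.
have TG : T *m row_mx Fm Em = block_mx (wronskian_mx f u)
    (row_mx 1%:M 0 *m Em) 0 (Td *m Em).
  rewrite /T mul_col_mx !mul_mx_row -/(block_mx _ _ _ _); congr block_mx.
    rewrite -[Fm]vsubmxK mul_row_col mul1mx mul0mx addr0.
    by apply/matrixP => i j; rewrite !mxE.
  apply/matrixP => r j; rewrite !mxE.
  rewrite -[RHS](@jt_op_col_relation N f phi U oU Hf Hphi r (N + m) u j Uu).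
    by apply: eq_bigr => p _; rewrite !mxE.
  by rewrite ltn_add2l.
have TdEm : Td *m Em = J^T *m diag_mx (\row_c (-1) ^+ col_pos l N c).
  apply/matrixP => r c; rewrite mul_mx_diag !mxE.
  rewrite (bigD1 (Ordinal (col_pos_lt l N c)))//= !mxE eqxx mulr1 big1 ?addr0.
    have e : N%:Z - (col_pos l N c)%:Z = (part (part_conj l) c)%:Z - c%:Z.
      by have := posE c; lia.
    by rewrite /rho mulrC e.
  by move=> p; rewrite -val_eqE /= => /negPf pc; rewrite !mxE pc mulr0.
have E : \det T * \det (row_mx Fm Em) = \det (wronskian_mx f u) * (\det J * S).
  rewrite -det_mulmx TG det_ublock TdEm det_mulmx det_tr det_diag.
  by congr (_ * (_ * _)); apply: eq_bigr => c _; rewrite mxE.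
have signC : (-1) ^+ s = \prod_(c < m) (-1) ^+ part (part_conj l) c :> C.
  have := congr1 (fun x : int => x%:~R : C) (sign_shuffle lN lm).
  rewrite rmorph_sign => ->; rewrite rmorph_prod/=.
  by apply: eq_bigr => c _; rewrite rmorphXn/= rmorphN1.
have signs : \det T * (-1) ^+ s = S * D part0 u ^+ m.
  rewrite detT signC -big_split/=.
  rewrite -[in RHS](card_ord m) -prodr_const -big_split/=.
  apply: eq_bigr => c _; rewrite posE exprD -[RHS]mulr1.
  by rewrite -[X in _ = _ * X](sqrr_sign C (part (part_conj l) c)); ring.
have S0 : S != 0 by apply/prodf_neq0 => c _; rewrite signr_eq0.
have {}E : D part0 u ^+ m * plucker f l u = \det (wronskian_mx f u) * \det J.
  by apply: (mulfI S0); rewrite mulrA -signs -mulrA -detG E; ring.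
transitivity (phi u * (\det (wronskian_mx f u) * \det J)).
  by rewrite /D /scaled_plucker plucker0; ring.
by rewrite -E {2}/D /scaled_plucker; ring.
Qed.

End Dual.

(** * From exact Pluecker coordinates to meromorphic ones *)

Section Transfer.
Variable R : realType.
Local Notation C := (R[i] : numFieldType).
Implicit Types (l : intpart) (u z w : C) (U : set C).

Lemma det_jt_matrix_eq_on U m l h h' u : open U -> U u ->
  (forall a : int, a <= (part l 0 + m)%N%:Z -> {in U, h a =1 h' a}) ->
  \det (jt_matrix m h l u) = \det (@jt_matrix R m h' l u).
Proof.
move=> oU Uu hh'; congr (\det _); apply/matrixP => i j; rewrite !mxE.
apply: eq_bigr => k _; congr (_ * _); apply: derive1n_eq_on oU _ Uu.
apply: hh'.
have := part_mono l (leq0n i); have := ltn_ord i; have := ltn_ord j; have := ltn_ord k.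
lia.
Qed.

Lemma solve_exprz (F : fieldType) (x y J : F) m : x != 0 ->
  J * x = y * x ^+ m -> y = x ^ (1 - m%:Z) * J.
Proof.
move=> x0 E; apply: (mulIf (expf_neq0 m x0)); rewrite -E.
rewrite expfzDr// expr1z -exprnN.
have : x ^+ m != 0 by exact: expf_neq0.
by move: (x ^+ m) => X X0; field.
Qed.

(** Punctured neighbourhoods are stable under finite intersections. *)
Lemma near_finite z0 K (P : nat -> C -> Prop) :
  (forall i, \forall z \near z0^', P i z) ->
  \forall z \near z0^', forall i, (i <= K)%N -> P i z.
Proof.
move=> HP; elim: K => [|K IH].
  by near=> z => i; rewrite leqn0 => /eqP ->; near: z; exact: HP.
near=> z => i; rewrite leq_eqVlt => /predU1P[->|].
  by near: z; exact: HP.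
by rewrite ltnS; move: i; near: z; exact: IH.
Unshelve. all: by end_near. Qed.

(** The zeros of the scaling and of the Wronskian are isolated, and only
  finitely many coordinates enter a given determinant. *)
Lemma good_disc N (f : 'I_N -> C -> C) (phi : C -> C) (Delta : intpart -> C -> C)
    l (K : nat) z0 :
  (forall j, holomorphic_on setT (f j)) ->
  (forall c : 'I_N -> C, (forall z, \sum_(j < N) c j * f j z = 0) -> forall j, c j = 0) ->
  meromorphic phi -> ~ mero_eq phi (fun=> 0) ->
  (forall l, mero_eq (Delta l) (fun u => phi u * plucker f l u)) ->
  exists U, [/\ open U, (\forall z \near z0^', U z), holomorphic_on U phi,
    (forall u, U u -> scaled_plucker f phi part0 u != 0) &
    (forall u, U u -> [/\ Delta l u = scaled_plucker f phi l u,
       Delta part0 u = scaled_plucker f phi part0 u &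
       forall i, (i <= K)%N ->
         Delta (part_row i) u = scaled_plucker f phi (part_row i) u /\
         Delta (part_col i) u = scaled_plucker f phi (part_col i) u])].
Proof.
move=> Hf indep mphi phi0 HD.
have HW : holomorphic_on setT (fun z => \det (wronskian_mx f z)).
  apply: hol_det => i j; apply: (hol_eq_on openT _ (hol_derive1n i openT (Hf j))).
  by move=> z _; rewrite mxE.
have W0 : \forall z \near z0^', \det (wronskian_mx f z) != 0.
  by have [/(wronskian_neq0 Hf indep)|] := entire_dichotomy HW.
have p0 : \forall z \near z0^', phi z != 0 by have [|] := mero_dichotomy mphi.
have [n [g [/nearC[d1 d10 H1] /dnearC[d2 d20 H2]]]] := mphi z0.
have DK : \forall z \near z0^', forall i, (i <= K)%N ->
    Delta (part_row i) z = scaled_plucker f phi (part_row i) z /\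
    Delta (part_col i) z = scaled_plucker f phi (part_col i) z.
  apply: near_finite => i.
  by apply: filterI; [exact: (HD (part_row i) z0)|exact: (HD (part_col i) z0)].
have DlD : \forall z \near z0^', Delta l z = scaled_plucker f phi l z /\
    Delta part0 z = scaled_plucker f phi part0 z.
  by apply: filterI; [exact: (HD l z0)|exact: (HD part0 z0)].
have /dnearC[d d0 H] : \forall z \near z0^',
    (\det (wronskian_mx f z) != 0 /\ phi z != 0) /\
    ((Delta l z = scaled_plucker f phi l z /\
      Delta part0 z = scaled_plucker f phi part0 z) /\
     forall i, (i <= K)%N ->
       Delta (part_row i) z = scaled_plucker f phi (part_row i) z /\
       Delta (part_col i) z = scaled_plucker f phi (part_col i) z).
  by do 2!apply: filterI => //; apply: filterI.
pose r := Num.min d (Num.min d1 d2).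
have r0 : 0 < r by rewrite !lt_min d0 d10.
pose U := [set z : C | z != z0 /\ nrm (z - z0) < r].
have sub z : U z -> [/\ z != z0, nrm (z - z0) < d, nrm (z - z0) < d1 & nrm (z - z0) < d2].
  by move=> [zz]; rewrite !lt_min => /and3P[].
have oU : open U.
  rewrite openE => z [zz0 zr]; apply/nearC.
  have [e e0 He] := open_disc_in (@open_cdisc R z0 r) zr.
  exists (Num.min e (nrm (z - z0))); first by rewrite lt_min e0 nrm_gt0 subr_eq0.
  move=> w; rewrite lt_min => /andP[we wz]; split; last exact: He.
  by apply: contraTneq wz => ->; rewrite nrmB ltxx.
exists U; split => //.
- by apply/dnearC; exists r.
- have := @hol_eq_on R U (fun z => g z * ((z - z0) ^+ n)^-1) phi oU; apply.
    by move=> z; rewrite inE => /sub[z1 _ _ z2]; rewrite H2.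
  apply: holM; first by move=> z /sub[_ _ /H1/derivableC].
  apply: holV => z /sub[z1 _ _ _]; first by rewrite expf_neq0// subr_eq0.
  case: n H2 => [_|n _]; first by exists 0; exact: cderiv_cst.
  by eexists; exact: cderivX_sub.
- move=> u /sub[u1 u2 _ _]; have [[w0 q0] _] := H u u1 u2.
  by rewrite /scaled_plucker plucker0 mulf_neq0.
- by move=> u /sub[u1 u2 _ _]; have [_ [[]]] := H u u1 u2.
Qed.

End Transfer.

Theorem theorem3p1 (R : realType) (N : nat)
    (V : set (R[i] -> R[i])) (f : 'I_N -> R[i] -> R[i])
    (phi : R[i] -> R[i]) (Delta : intpart -> R[i] -> R[i])
    (V_entire : V `<=` @entire R)
    (f_basis : is_basis V f)
    (phi_mero : meromorphic phi)
    (phi_neq0 : ~ mero_eq phi (fun=> 0))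
    (Delta_plucker : forall l : intpart,
       mero_eq (Delta l) (fun u => phi u * plucker f l u)) :
  (forall (l : intpart) (m : nat), (size l <= m)%N ->
     mero_eq (Delta l) (fun u =>
       Delta part0 u ^ (1 - m%:Z) *
       \det (jt_matrix m (at_row Delta) l u))) /\
  (forall (l : intpart) (m : nat), (part l 0 <= m)%N ->
     mero_eq (Delta l) (fun u =>
       Delta part0 u ^ (1 - m%:Z) *
       \det (jt_matrix m (at_col Delta) (part_conj l) u))).
Proof.
have [indep VE] := f_basis.
have Hf j : holomorphic_on setT (f j).
  move=> z _; apply/derivableC; apply: V_entire; rewrite VE.
  exists (fun k => (k == j)%:R) => w.
  rewrite (bigD1 j)//= eqxx mul1r big1 ?addr0// => k /negPf->.
  by rewrite mul0r.
split=> l m lm z0.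
  have [U [oU nU Hphi D0 DE]] := good_disc l (part l 0 + m) z0 Hf indep
    phi_mero phi_neq0 Delta_plucker.
  apply: filterS nU => u Uu; have [-> -> _] := DE u Uu.
  apply: solve_exprz; first exact: D0.
  rewrite -(jacobi_trudi oU (fun j => sub_hol (@subsetT _ _) (Hf j)) Hphi Uu (D0 u Uu) lm).
  congr (_ * _); apply: (det_jt_matrix_eq_on oU Uu) => -[i|//] iK w.
  by rewrite inE => /DE[_ _ H]; have [] := H i iK.
have [U [oU nU Hphi D0 DE]] := good_disc l (part (part_conj l) 0 + m) z0 Hf indep
  phi_mero phi_neq0 Delta_plucker.
apply: filterS nU => u Uu; have [-> -> _] := DE u Uu.
apply: solve_exprz; first exact: D0.
rewrite -(dual_jacobi_trudi oU (fun j => sub_hol (@subsetT _ _) (Hf j)) Hphi Uu (D0 u Uu) lm).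
congr (_ * _); apply: (det_jt_matrix_eq_on oU Uu) => -[i|//] iK w.
by rewrite inE => /DE[_ _ H]; have [] := H i iK.
Qed.
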